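(* Let $k\ge 2$ be an integer. Then $g_k(n)=(k+1)(n-k-1)$ for every integer $n\ge \lceil (5k+1)/2\rceil$. Moreover, this threshold is sharp: for $n=\lceil (5k+1)/2\rceil-1$ there exists an $n$-vertex graph with $(k+1)(n-k-1)+1$ edges containing no cycle $C$ with a vertex of $C$ incident with at least $k$ chords of $C$.
   Context: All graphs are finite and simple. A chord of a cycle $C$ in a graph $G$ is an edge of $G$ joining two vertices of $C$ that are not consecutive on $C$. For integers $k\ge1$ and $n\ge k+2$, $g_k(n)$ denotes the maximum number of edges in an $n$-vertex graph containing no cycle $C$ with a vertex (of $C$) incident with at least $k$ chords of $C$. *)

(* Defs.v *)
From mathcomp Require Import all_boot.
From mathcomp Require Import boolp.

Set Implicit Arguments.
Unset Strict Implicit.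
Unset Printing Implicit Defensive.

(* A graph on the vertex type T is represented by its edge set E, a set of
   unordered pairs, so that #|E| is the number of edges. *)
Definition simple_graph (T : finType) (E : {set {set T}}) : bool :=
  [forall e in E, #|e| == 2].

Definition adj (T : finType) (E : {set {set T}}) : rel T :=
  fun x y => [set x; y] \in E.

(* A cycle is the list of its distinct vertices in cyclic order. *)
Definition is_cycle (T : finType) (E : {set {set T}}) (c : seq T) : bool :=
  (2 < size c) && ucycleb (adj E) c.

Definition chords (T : finType) (E : {set {set T}}) (c : seq T) : {set {set T}} :=
  [set e in E | (e \subset c) && [forall x in c, e != [set x; next c x]]].

Definition chords_at (T : finType) (E : {set {set T}}) (c : seq T) (v : T) :
    {set {set T}} :=
  [set e in chords E c | v \in e].

Definition chord_cycle_free (k : nat) (T : finType) (E : {set {set T}}) : Prop :=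
  ~ (exists (c : seq T) (v : T),
       [/\ is_cycle E c, v \in c & k <= #|chords_at E c v|]).

(* Every n-vertex graph is isomorphic to one on 'I_n. For k > 0 the edgeless
   graph is admissible, so the maximum is over a nonempty family. *)
Definition g (k n : nat) : nat :=
  \max_(E : {set {set 'I_n}} | simple_graph E && `[< chord_cycle_free k E >]) #|E|.

(* Main.v *)
Require Import Defs.
From Stdlib Require Import ZArith.
From mathcomp Require Import all_boot zify.
From mathcomp Require Import boolp.

Set Implicit Arguments.
Unset Strict Implicit.
Unset Printing Implicit Defensive.

(* Write K = k + 1: every vertex of a cycle has at most K neighbours on it.  In
   particular every subgraph has a vertex of degree at most K (an end of a longest
   path), so it is enough to treat n <= n0 = ceil((5k+1)/2), and there a bound
   tau(n) with tau(n0) = K (n0 - K) is proved by strong induction on n.  The slope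
   of tau is floor((n+1)/3) (for K = 3, 4 take tau(n) = floor(nK/2) instead), so in
   the induction step the minimum degree is at least (n+2)/3; a cut vertex or a
   Hamiltonian cycle (at most nK/2 edges) is harmless.  Otherwise let C be a longest
   cycle, of length c: by Dirac c is at least twice the minimum degree, and by
   Nash-Williams the vertices outside C are independent.
   If s is the largest degree of a vertex v outside C, then 2s <= c and s <= K,
   and the successors on C of two neighbours of v have at most c neighbours on C
   together.  Hence 4 e(G) <= 2 (c - s) K + s c + 4 (n - c) s, and this is at most
   4 tau(n) + 2; the extremal case is c = 2s, s in {K - 1, K}.
   Sharpness: join k vertices spanning a matching to an independent set. *)

(** * The numerical bound *)

(* The increment [tri n - tri n.-1] is floor((n+1)/3): a minimum degree above it
   satisfies the hypothesis of [longest_cycle_dominating]. *)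
Definition tri (n : nat) : nat := (n * n.+1) %/ 6.

(** Modulo 6 the product [n * n.+1] is 0 or 2, so inequalities about [tri] become polynomial ones
    with a slack of at most 2. *)
Lemma tri_spec n : exists2 r, r <= 1 & n * n.+1 = 6 * tri n + 2 * r.
Proof.
have h : (n * n.+1) %% 6 \in [:: 0; 2].
  rewrite -modnMm -[n.+1]addn1 -(modnDml n).
  have : n %% 6 < 6 by rewrite ltn_mod.
  by case: (n %% 6) => [|[|[|[|[|[|m]]]]]].
have E := divn_eq (n * n.+1) 6; rewrite -/(tri n) in E; rewrite !inE in h.
case/orP: h => /eqP h; rewrite h in E.
- by exists 0 => //; rewrite {1}E; lia.
- by exists 1 => //; rewrite {1}E; lia.
Qed.

Lemma tri_mono m n : m <= n -> tri m <= tri n.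
Proof. by move=> h; apply: leq_div2r; apply: leq_mul. Qed.

(** Used at a cut vertex, with [a] and [b] the sizes of the two sides. For [n = a + b - 1], three
    times the difference of the unrounded sides is [2 (a - 1) (b - a)]. *)
Lemma tri_block a b n : 0 < a <= b -> a + b <= n.+1 -> a * a.-1 + (tri b).*2 <= (tri n).*2.
Proof.
move=> /andP[a0 ab] abn.
suff h : a * a.-1 + (tri b).*2 <= (tri (a + b).-1).*2.
  by apply: leq_trans h _; rewrite leq_double; apply: tri_mono; move: abn; clear; lia.
have [r r1 E] := tri_spec b; have [s s1 F] := tri_spec (a + b).-1.
have [c cE] : exists c, a = c.+1 by exists a.-1; rewrite prednK.
move: F; rewrite cE addSn /= => F; move: (tri b) (tri (c + b)) E F => x y E F.
nia.
Qed.
Lemma tri_step d n : 0 < n -> tri n < tri n.-1 + d -> n + 2 <= 3 * d.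
Proof.
move=> n0; have [m ->] : exists m, n = m.+1 by exists n.-1; rewrite prednK.
have [r r1 E] := tri_spec m; have [s s1 F] := tri_spec m.+1.
rewrite /= in F *; move: (tri m) (tri m.+1) E F => x y E F h; nia.
Qed.
Lemma tri_lt n : 2 <= n -> tri n.-1 < tri n.
Proof.
case: n => [|[|m]] // _; rewrite /=.
have [r r1 E] := tri_spec m.+1; have [s s1 F] := tri_spec m.+2.
move: (tri m.+1) (tri m.+2) E F => x y E F; nia.
Qed.

(** In the application [h = K - s], [j = n0 - n] and [t = 5 K - 2 n0]. Completing the square in
    [3 h - j] leaves at worst [-8], which [2 (K - 1) j] pays for once [j >= 1]; for [j = 0] the
    integrality of [h] is used. *)
Lemma quadratic_nonneg (h j K t : Z) : (5 <= K)%Z -> (0 <= h)%Z -> (0 <= j)%Z ->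
  (t = 3 \/ t = 4)%Z ->
  (0 <= 2 * (3 * h - j) * (3 * h - j) - 2 * t * (3 * h - j) + 2 * (K - 1) * j + 7)%Z.
Proof.
move=> hK hh hj ht.
have [j0|j1] : (j = 0 \/ 1 <= j)%Z by lia.
  subst j; have [h0|[h1|h2]] : (h = 0 \/ h = 1 \/ 2 <= h)%Z by lia.
  - by subst h; lia.
  - by subst h; case: ht => ->; lia.
  - by case: ht => ->; nia.
have sq := Z.square_nonneg (2 * (3 * h - j) - t).
have hj8 : (8 <= 2 * (K - 1) * j)%Z by nia.
set w := (3 * h - j)%Z in sq *; clearbody w.
by case: ht => tE; subst t; nia.
Qed.

(* Up to the factor 12, [s * (2 * n + K - 3 * s) / 2] edges arise by joining s
   vertices inducing a (K - s)-regular graph to n - s independent ones. *)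
Lemma join_edges_bound K n0 n s t : 5 <= K -> 5 * K = 2 * n0 + t -> 3 <= t <= 4 -> n <= n0 -> s <= K ->
  6 * s * (2 * n + K) + 12 * K * K + 2 * (n0 * n0.+1) <= 12 * K * n0 + 2 * (n * n.+1) + 18 * s * s + 7.
Proof.
move=> K5 h0 ht hn hs.
have := @quadratic_nonneg (Z.of_nat K - Z.of_nat s) (Z.of_nat n0 - Z.of_nat n)
   (Z.of_nat K) (5 * Z.of_nat K - 2 * Z.of_nat n0).
move=> H; have {}H := H ltac:(lia) ltac:(lia) ltac:(lia) ltac:(lia).
lia.
Qed.

(** The function [tau] for [K >= 5]: [tri] shifted to take the value [K * (n0 - K)] at [n0]. By
    [tri_le_bound] the subtraction does not truncate. *)
Definition edge_bound (K n0 n : nat) : nat := K * (n0 - K) - tri n0 + tri n.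

Lemma tri_le_bound K n0 t : 5 <= K -> 5 * K = 2 * n0 + t -> 3 <= t <= 4 ->
  tri n0 <= K * (n0 - K).
Proof.
move=> K5 h0 ht; have [r r1 E] := tri_spec n0.
have [m mE] : exists m, n0 = K + m by exists (n0 - K); lia.
have -> : n0 - K = m by lia.
move: (tri n0) E => x E; subst n0; nia.
Qed.

Lemma edge_bound_spec K n0 t n : 5 <= K -> 5 * K = 2 * n0 + t -> 3 <= t <= 4 ->
  exists r r0, [/\ r <= 1, r0 <= 1 &
   6 * edge_bound K n0 n + 6 * K * K + n0 * n0.+1 + 2 * r = 6 * K * n0 + n * n.+1 + 2 * r0].
Proof.
move=> K5 h0 ht; have hT := tri_le_bound K5 h0 ht.
have [r r1 E] := tri_spec n; have [r0 r01 E0] := tri_spec n0.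
exists r, r0; split => //; rewrite /edge_bound.
have hP : K * (n0 - K) + K * K = K * n0 by rewrite -mulnDr subnK //; move: h0 ht K5; clear; lia.
move: E E0 hT hP; move: (tri n) (tri n0) (K * (n0 - K)) (n * _) (n0 * _) => a b c u v.
by clear; lia.
Qed.

(** Completing the square in [n] ([w] equals [3 K - 2 n - 1]) leaves a rest free of [n], nonnegative
    in the two listed cases. *)
Lemma hamiltonian_discriminant_nonneg (K n0 n t : Z) : (5 * K = 2 * n0 + t)%Z ->
  (t = 3 /\ 5 <= K \/ t = 4 /\ 7 <= K)%Z ->
  (3 * n * K + n0 * (n0 + 1) + 6 * K * K <= 6 * K * n0 + n * (n + 1) + 1)%Z.
Proof.
move=> h0 hK; set w := (2 * (n0 - n) + t - 2 * K - 1)%Z.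
have sq := Z.square_nonneg w.
have q : (0 <= 2 * K * (K - 2 - t) - (t - 1) * (t - 1) + 4)%Z.
  case: hK => [[-> hK]|[-> hK]].
    by have := Z.mul_nonneg_nonneg K (K - 5); lia.
  by have := Z.mul_nonneg_nonneg (K - 7) (K + 1); lia.
have E : (4 * (6 * K * n0 + n * (n + 1) + 1 - (3 * n * K + n0 * (n0 + 1) + 6 * K * K)) =
    w * w + (2 * K * (K - 2 - t) - (t - 1) * (t - 1) + 4))%Z.
  have tE : (t = 5 * K - 2 * n0)%Z by rewrite h0; ring.
  by rewrite /w tE; ring.
by move: E sq q; clear; lia.
Qed.

(* False for K = 3 and K = 4, which are therefore treated separately. *)
Lemma edge_bound_ham K n0 t n : 5 <= K -> 5 * K = 2 * n0 + t -> 3 <= t <= 4 -> n <= n0 ->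
  n * K <= (edge_bound K n0 n).*2.+1.
Proof.
move=> K5 h0 ht hn; have [K6|K6] := eqVneq K 6.
  have n13 : n0 = 13 by move: h0 ht; rewrite K6; clear; lia.
  have : n \in iota 0 14 by rewrite mem_iota add0n ltnS -n13.
  rewrite K6 n13; move: n {hn}; apply/allP; by vm_compute.
have [r [r0 [r1 r01]]] := edge_bound_spec n K5 h0 ht.
move: (edge_bound K n0 n) => b E.
have h0Z : (5 * Z.of_nat K = 2 * Z.of_nat n0 + Z.of_nat t)%Z by move: h0; clear; lia.
have := @hamiltonian_discriminant_nonneg _ _ (Z.of_nat n) _ h0Z.
have hK : (Z.of_nat t = 3 /\ 5 <= Z.of_nat K \/ Z.of_nat t = 4 /\ 7 <= Z.of_nat K)%Z.
  by move: K5 K6 h0 ht; clear; lia.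
by move=> /(_ hK); move: E r1 r01; clear; lia.
Qed.

(** Up to [n0] the increments of [tri] are at most [K], so going down from [n0] the bound stays
    above the line of slope [K]. *)
Lemma edge_bound_lower K n0 t n : 5 <= K -> 5 * K = 2 * n0 + t -> 3 <= t <= 4 -> n <= n0 ->
  K * n <= edge_bound K n0 n + K * K.
Proof.
move=> K5 h0 ht hn.
have [r [r0 [r1 r01]]] := edge_bound_spec n K5 h0 ht.
have [j jE] : exists j, n0 = n + j by exists (n0 - n); lia.
move: (edge_bound K n0 n) => b E; subst n0.
have [j0|j0] : j = 0 \/ 0 < j by lia.
  subst j; nia.
nia.
Qed.

(** [D] is the degree sum, [k] the length of the longest cycle, [s] the largest degree off it. The
    first estimate of [D] is linear in [k], and the sign of [2 K - 3 s] decides which end of the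
    range of [k] is worst; for [k >= 2 * K] the second estimate suffices. *)
Lemma dominating_edge_bound K n0 t n s k D : 5 <= K -> 5 * K = 2 * n0 + t -> 3 <= t <= 4 ->
  n <= n0 -> s <= K -> 2 * s <= k -> k < n -> ~~ odd D ->
  2 * D <= 2 * (k - s) * K + s * k + 4 * (n - k) * s ->
  D <= k * K + 2 * (n - k) * s -> D <= (edge_bound K n0 n).*2.
Proof.
move=> K5 h0 ht hn sK sk kn Dev h1 h2.
have hl := edge_bound_lower K5 h0 ht hn.
have hh := edge_bound_ham K5 h0 ht hn.
have [j jE] : exists j, n = k + j by exists (n - k); lia.
have [i iE] : exists i, k = 2 * s + i by exists (k - 2 * s); lia.
have E1 : n - k = j by lia.
have E2 : k - s = s + i by lia.
rewrite E1 E2 in h1 h2.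
have [kK|kK] := leqP (2 * K) k.
  clear -hl jE sK kK h2; move: (edge_bound _ _ _) hl => b hl; subst n; nia.
suff : D <= (edge_bound K n0 n).*2.+1 by move: Dev; clear; lia.
(* Nonincreasing in [k]: the worst case is [k = 2 s], which gives the join estimate. *)
have [sK3|sK3] := leqP (2 * K) (3 * s).
  have h3 := join_edges_bound K5 h0 ht hn sK.
  have [r [r0 [r1 r01]]] := edge_bound_spec n K5 h0 ht.
  have h4 : D <= s * (2 * n + K - 3 * s).
    have [m mE] : exists m, 2 * n + K = m + 3 * s by exists (2 * n + K - 3 * s); lia.
    have -> : 2 * n + K - 3 * s = m by lia.
    clear -h1 jE iE sK3 mE; subst n k; nia.
  have h5 : s * (2 * n + K - 3 * s) + 3 * s * s = s * (2 * n + K).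
    by rewrite mulnBr; rewrite -mulnA (mulnCA 3) subnK // leq_mul2l; apply/orP; right; lia.
  move: (edge_bound _ _ _) => b E.
  clear -h3 h4 h5 E r1 r01; nia.
(* Increasing in [k]: here [k] is replaced by [2 K], and in the remaining case by [n], which leads
   back to the Hamiltonian bound. *)
have [nK|nK] := leqP (2 * K) n.
  have [v vE] : exists v, 2 * K = k + v by exists (2 * K - k); lia.
  have [u uE] : exists u, n = 2 * K + u by exists (n - 2 * K); lia.
  have p1 : 3 * s * v <= 2 * K * v by rewrite leq_mul2r ltnW ?orbT.
  have p2 : s * u <= K * u by rewrite leq_mul2r sK orbT.
  move: (edge_bound _ _ _) hl => b hl.
  have q1 : 2 * (s + i) * K + 2 * (s * K) = 2 * (k * K) by rewrite iE; clear; lia.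
  have q2 : k * K + v * K = 2 * (K * K) by rewrite -mulnDl -vE; clear; lia.
  have q3 : s * k + s * v = 2 * (s * K) by rewrite -mulnDr -vE; clear; lia.
  have q4 : j * s = u * s + v * s.
    by rewrite -mulnDl; congr (_ * _); move: vE uE jE; clear; lia.
  have q5 : K * n = 2 * (K * K) + K * u by rewrite uE; clear; lia.
  move: hl h1 q1 q2 q3 q4 q5 p1 p2; clear; lia.
have [v vE] : exists v, 2 * K = n + v by exists (2 * K - n); lia.
have p1 : 3 * s * j <= 2 * K * j by rewrite leq_mul2r ltnW ?orbT.
have q1 : 2 * (s + i) * K + 2 * (s * K) = 2 * (k * K) by rewrite iE; clear; lia.
have q2 : n * K = k * K + j * K by rewrite jE mulnDl.
have q3 : 2 * (K * s) = n * s + v * s by rewrite mulnA vE mulnDl.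
have q4 : n * s = k * s + j * s by rewrite jE mulnDl.
apply: leq_trans hh; move: h1 p1 q1 q2 q3 q4; clear; lia.
Qed.

(** * Longest cycles *)

Ltac perm_solve :=
  apply/permP => ?; do ![rewrite count_cat | rewrite count_rev | rewrite -cats1 | progress simpl]; clear; lia.

Section Graph.
Variables (T : finType) (e : rel T).
Hypotheses (e_sym : symmetric e) (e_irr : irreflexive e).

Definition nbr (x : T) : {set T} := [set y | e x y].

Definition deg (U : {set T}) (x : T) : nat := #|nbr x :&: U|.

Definition cycle_in (U : {set T}) (c : seq T) : bool :=
  [&& 2 < size c, cycle e c, uniq c & all (mem U) c].

Definition longest_cycle (U : {set T}) (c : seq T) : Prop :=
  cycle_in U c /\ forall c', cycle_in U c' -> size c' <= size c.

Definition path_off (U : {set T}) (c : seq T) (x : T) (q : seq T) : bool :=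
  [&& path e x q, uniq (x :: q) & all (fun y => (y \in U) && (y \notin c)) (x :: q)].

Lemma longest_cycle_rot U c i : longest_cycle U c -> longest_cycle U (rot i c).
Proof.
case=> /and4P[h1 h2 h3 h4] hm; split; last by move=> c' /hm; rewrite size_rot.
by rewrite /cycle_in size_rot rot_cycle rot_uniq h1 h2 h3 /= (eq_all_r (mem_rot i c)).
Qed.

Lemma rev_path_sym x q : path e x q = path e (last x q) (rev (belast x q)).
Proof.
by rewrite rev_path; apply: eq_path => y z; rewrite /= e_sym.
Qed.

Lemma path_off_rev U c x q : path_off U c x q ->
  exists q', [/\ path_off U c (last x q) q', last (last x q) q' = x,
    size q' = size q & last x q :: q' = rev (x :: q)].
Proof.
move=> /and3P[h1 h2 h3]; exists (rev (belast x q)).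
have E : last x q :: rev (belast x q) = rev (x :: q) by rewrite [x :: q]lastI rev_rcons.
split=> //; last by rewrite size_rev size_belast.
  by rewrite /path_off E rev_uniq all_rev h2 h3 -rev_path_sym h1.
by case: (q) => [//|y q'] /=; rewrite rev_cons last_rcons.
Qed.

Lemma path_off_perm (U : {set T}) (c c' : seq T) x q : perm_eq c c' ->
  path_off U c x q -> path_off U c' x q.
Proof.
move=> /perm_mem cc' /and3P[h1 h2 h3]; rewrite /path_off h1 h2 /=.
by apply: sub_all h3 => y; rewrite cc'.
Qed.

Lemma splice_in (U : {set T}) (c q s l : seq T) : uniq c -> all (mem U) c -> uniq q ->
  all (fun y => (y \in U) && (y \notin c)) q -> subseq s c -> perm_eq l (s ++ q) ->
  uniq l /\ all (mem U) l.
Proof.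
move=> uc aU uq aq ss pl; rewrite (perm_uniq pl) (perm_all _ pl) cat_uniq all_cat.
rewrite (subseq_uniq ss uc) uq andbT; split.
  by apply/hasPn => y /(allP aq) /andP[_]; apply: contra; apply: (mem_subseq ss).
apply/andP; split; first by apply/allP => y /(mem_subseq ss); apply: (allP aU).
by apply: sub_all aq => y /andP[].
Qed.

(* Otherwise the detour x :: q could replace the arc s1. *)
Lemma arc_bound U u s1 v s2 x q :
  longest_cycle U (u :: s1 ++ v :: s2) -> path_off U (u :: s1 ++ v :: s2) x q ->
  e u x -> e (last x q) v -> size q < size s1.
Proof.
move=> [/and4P[_ hc hu ha] hm] /and3P[hp hq1 hq2] eux exv.
have/hm : cycle_in U (u :: (x :: q) ++ v :: s2).
  have [] := @splice_in U _ (x :: q) (u :: v :: s2) (u :: (x :: q) ++ v :: s2) hu ha hq1 hq2.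
  - by rewrite /= eqxx suffix_subseq.
  - by perm_solve.
  move=> u1 a1; rewrite /cycle_in u1 a1 !andbT; apply/andP; split.
    by rewrite /= size_cat /=; clear; lia.
  move: hc; rewrite !(cat_path, rcons_cat, rcons_path, cat_cons) /= !(cat_path, rcons_path) /=.
  rewrite eux hp exv /=.
  by move=> /andP[/and3P[_ _ ->]]; rewrite !last_cat /=.
by rewrite /= !size_cat /=; clear; lia.
Qed.

(** * Spacing of neighbours along a longest cycle *)

Section Gaps.
Variables (Y1 Y2 : {set T}) (m : nat) (a0 : T).

(* Y1 and Y2 will be the neighbours on a longest cycle of the two ends of a path
   outside it; an arc from one to the other is at least as long as that path. *)
Definition mixed (a b : T) : bool :=
  (a \in Y1) && (b \in Y2) || (a \in Y2) && (b \in Y1).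

(** A lower bound for a distance along the cycle. An end of the path could be inserted between two
    consecutive vertices, so its neighbours are at least 2 apart; a path with [m] edges adds [m]
    between a mixed pair. *)
Definition gap (a b : T) : nat := 2 + (if mixed a b then m else 0).

Fixpoint gap_sum (a : T) (f : seq T) : nat :=
  if f is b :: f' then gap a b + gap_sum b f' else gap a a0.

(** A vertex of [Y1 :&: Y2] forms a mixed pair with whatever member of the union follows it, so each
    one brings its own extra [m]. *)
Lemma gap_sum_inter a f : a0 \in Y1 :|: Y2 -> all (mem (Y1 :|: Y2)) (a :: f) ->
  2 * (size f).+1 + m * count (mem (Y1 :&: Y2)) (a :: f) <= gap_sum a f.
Proof.
move=> a0T; elim: f a => [|b f IH] a.
  rewrite /= /gap /mixed !inE andbT; move: a0T; rewrite inE.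
  by case: (a \in Y1); case: (a \in Y2); case: (a0 \in Y1); case: (a0 \in Y2) => //=; lia.
rewrite [all _ _]/= => /andP[aT bT]; move: (IH b bT).
rewrite [gap_sum a _]/= [count _ (a :: _)]/= /gap /mixed !inE.
move: bT => /= /andP[]; rewrite !inE => + _.
by case: (a \in Y1); case: (a \in Y2); case: (b \in Y1); case: (b \in Y2) => //=; lia.
Qed.

Lemma gap_sum_switch1 a f : a0 \in Y1 -> a \in Y2 -> all (mem (Y1 :|: Y2)) f ->
  2 * (size f).+1 + m <= gap_sum a f.
Proof.
move=> a0Y; elim: f a => [|b f IH] a aY /=.
  by rewrite /gap /mixed aY a0Y orbT.
rewrite inE => /andP[bT fT]; have [bY|bN] := boolP (b \in Y2).
  by have := IH _ bY fT; rewrite /gap; lia.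
have := @gap_sum_inter b f; rewrite !inE a0Y /= inE bT fT => /(_ isT isT).
by rewrite /gap /mixed aY; move: bT; rewrite (negbTE bN) orbF => -> /=; rewrite orbT; lia.
Qed.

(* Starting and ending in Y1 and visiting Y2, the walk changes sides twice. *)
Lemma gap_sum_switch2 a f : a0 \in Y1 -> a \in Y1 -> has (mem Y2) f ->
  all (mem (Y1 :|: Y2)) f -> 2 * (size f).+1 + m * 2 <= gap_sum a f.
Proof.
move=> a0Y; elim: f a => [//|b f IH] a aY /= + /andP[].
rewrite inE; have [bY _ _ fT|bN /= hf bY fT] := boolP (b \in Y2).
  by have := gap_sum_switch1 a0Y bY fT; rewrite /gap /mixed aY bY /=; lia.
by move: bY; rewrite orbF => bY; have := IH _ bY hf fT; rewrite /gap; lia.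
Qed.

End Gaps.

Section GapBound.
Variables (U : {set T}) (x : T) (q : seq T) (Y1 Y2 : {set T}).
Hypotheses (Y1x : Y1 \subset nbr x) (Y2q : Y2 \subset nbr (last x q)).

(** For a mixed pair the detour is the path or its reversal, otherwise the single end adjacent to
    both vertices; then [arc_bound] applies. *)
Lemma gap_arc a s1 b s2 : longest_cycle U (a :: s1 ++ b :: s2) ->
  path_off U (a :: s1 ++ b :: s2) x q ->
  a \in Y1 :|: Y2 -> b \in Y1 :|: Y2 -> gap Y1 Y2 (size q) a b <= (size s1).+1.
Proof.
move=> lc pq aT bT.
have h1 y : y \in Y1 -> e x y by move=> /(subsetP Y1x); rewrite inE.
have h2 y : y \in Y2 -> e (last x q) y by move=> /(subsetP Y2q); rewrite inE.
have [q' [pq' lq' sq' _]] := path_off_rev pq.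
have px : path_off U (a :: s1 ++ b :: s2) x [::].
  by move: pq => /and3P[_ _ /andP[h _]]; rewrite /path_off /= h.
have pl : path_off U (a :: s1 ++ b :: s2) (last x q) [::].
  by move: pq' => /and3P[_ _ /andP[h _]]; rewrite /path_off /= h.
rewrite /gap /mixed; move: aT bT; rewrite !inE.
case a1 : (a \in Y1); case a2 : (a \in Y2) => //= _;
case b1 : (b \in Y1); case b2 : (b \in Y2) => //= _;
 (try by (have := arc_bound lc pq; rewrite e_sym h1 // h2 //; clear; lia));
 (try by (have := arc_bound lc pq'; rewrite sq' lq' e_sym h2 // h1 //; clear; lia));
 (try by (have := arc_bound lc px; rewrite /= e_sym !h1 //; clear; lia));
 (try by (have := arc_bound lc pl; rewrite /= e_sym !h2 //; clear; lia)).
Qed.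

(** Induction along the cycle cut at [a0]: [a] is the last member of the union met so far, [N] the
    vertices passed since, [R] what remains. The last hypothesis provides a second member, so the
    closing arc from [a] to [a0] has distinct ends. *)
Lemma gap_sum_cycle a0 c P a N R : longest_cycle U c -> path_off U c x q ->
  c = P ++ a :: N ++ R -> head a0 c = a0 -> a0 \in Y1 :|: Y2 -> a \in Y1 :|: Y2 ->
  (P != [::]) || has (mem (Y1 :|: Y2)) R ->
  gap_sum Y1 Y2 (size q) a0 a (filter (mem (Y1 :|: Y2)) R) <= (size N + size R).+1.
Proof.
move=> lc pq; elim: R P a N => [|b R IH] P a N cE hc a0T aT hP.
  move: hP; rewrite orbF /= addn0; case: P cE => [//|a1 P] cE _.
  have {}cE : c = a0 :: P ++ a :: N by move: hc; rewrite cE cats0 /= => ->.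
  have := longest_cycle_rot (size (a0 :: P)) lc; rewrite {1}cE rot_size_cat => lc'.
  apply: (@gap_arc _ _ _ P lc' _ aT a0T).
  by apply: path_off_perm pq; rewrite cE; perm_solve.
rewrite /=; case: ifP => bT; last first.
  have := IH P a (rcons N b); rewrite cE cat_rcons size_rcons; rewrite -cE.
  move=> /(_ erefl hc a0T aT); rewrite /= in hP; rewrite /= bT in hP.
  by move=> /(_ hP) /=; clear; lia.
have := longest_cycle_rot (size P) lc; rewrite {1}cE rot_size_cat => lc'.
have /= g1 : gap Y1 Y2 (size q) a b <= (size N).+1.
  move: lc'; rewrite cat_cons -catA cat_cons => lc'.
  apply: (gap_arc lc' _ aT bT).
  by apply: path_off_perm pq; rewrite cE; perm_solve.
have := IH (P ++ a :: N) b [::]; rewrite -catA /= => /(_ cE hc a0T bT).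
have -> : (P ++ a :: N != [::]) by case: (P).
by move=> /(_ isT) /=; move: g1; clear; lia.
Qed.

(** The arcs between consecutive members of [Y1 :|: Y2] add up to the cycle. The two terms of the
    maximum come from [gap_sum_switch2] and [gap_sum_inter]. *)
Lemma gap_bound c a0 a1 : longest_cycle U c -> path_off U c x q ->
  Y1 \subset c -> Y2 \subset c -> a0 \in Y1 -> a1 \in Y2 -> a0 != a1 ->
  2 * #|Y1 :|: Y2| + maxn (size q * 2) (size q * #|Y1 :&: Y2|) <= size c.
Proof.
move=> lc pq Y1c Y2c a0Y a1Y a01.
have a0c : a0 \in c := subsetP Y1c _ a0Y.
case: (rot_to a0c) => i l cE.
have lc' := longest_cycle_rot i lc; rewrite cE in lc'.
have mc : c =i a0 :: l by move=> y; rewrite -cE mem_rot.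
have sc : size c = (size l).+1 by rewrite -(size_rot i) cE.
have pq' : path_off U (a0 :: l) x q.
  by apply: path_off_perm pq; rewrite -cE perm_sym perm_rot.
have a0T : a0 \in Y1 :|: Y2 by rewrite inE a0Y.
have a1l : a1 \in l.
  by have := subsetP Y2c _ a1Y; rewrite mc inE eq_sym (negbTE a01).
have hT : has (mem (Y1 :|: Y2)) l.
  by apply/hasP; exists a1 => //=; rewrite inE a1Y orbT.
have := @gap_sum_cycle a0 _ [::] a0 [::] l lc' pq' erefl erefl a0T a0T hT.
rewrite /= add0n -sc; set f := filter _ l => hs.
have ul : uniq (a0 :: l) by case: lc' => /and4P[].
have fT : all (mem (Y1 :|: Y2)) f by apply: filter_all.
have cardE (Y : {set T}) : Y \subset c -> #|Y| = count (mem Y) (a0 :: l).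
  move=> Yc; rewrite -size_filter -(card_uniqP (filter_uniq _ ul)).
  apply: eq_card => y; rewrite mem_filter /=.
  by case yY: (y \in Y) => //=; rewrite -mc (subsetP Yc).
have E1 : #|Y1 :|: Y2| = (size f).+1.
  have /cardE -> : Y1 :|: Y2 \subset c.
    by apply/subsetP => y; rewrite inE => /orP[/(subsetP Y1c)|/(subsetP Y2c)].
  by rewrite -size_filter /= a0T.
have E2 : #|Y1 :&: Y2| = count (mem (Y1 :&: Y2)) (a0 :: f).
  rewrite cardE; last by apply: subset_trans Y1c; apply: subsetIl.
  rewrite [RHS]/= /f count_filter [LHS]/=; congr (_ + _); apply: eq_count => y /=.
  by rewrite !inE; case: (y \in Y1); case: (y \in Y2).
have hf : has (mem Y2) f.
  by apply/hasP; exists a1 => //=; rewrite mem_filter /= a1l inE a1Y orbT.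
have faT : all (mem (Y1 :|: Y2)) (a0 :: f) by apply/andP.
have h1 := gap_sum_inter (size q) a0T faT.
have h2 := gap_sum_switch2 (size q) a0Y a0Y hf fT.
rewrite -E2 in h1; rewrite E1 /maxn; case: ifP => _; [apply: leq_trans h1 hs | apply: leq_trans h2 hs].
Qed.

End GapBound.

(** * Crossing neighbours on a path and degrees of successors *)

(** Ore's exchange: run from [z'] to the end of the path, jump to [z] and return backwards to the
    head, which is adjacent to [z']. *)
Lemma cross_cycle a z z' b : sorted e (rcons a z ++ z' :: b) ->
  e (head z a) z' -> e (last z' b) z -> cycle e ((z' :: b) ++ rev (rcons a z)).
Proof.
move=> hs hx hy; rewrite rev_rcons /= rcons_cat cat_path rcons_cons /= hy andbC /=.
case: a hs hx => [|a1 a] /=; first by move=> /andP[_ ->] ->.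
rewrite cat_path /= last_rcons => /and3P[+ _ ->] hx.
by rewrite rev_path_sym last_rcons belast_rcons rcons_path rev_cons last_rcons hx !andbT.
Qed.

Lemma longest_cycle_no_cross U c q a z z' b : longest_cycle U c ->
  all (fun y => (y \in U) && (y \notin c)) q -> uniq q -> q != [::] ->
  sorted e (rcons a z ++ z' :: b) -> perm_eq (rcons a z ++ z' :: b) (c ++ q) ->
  ~~ (e (head z a) z' && e (last z' b) z).
Proof.
move=> [/and4P[h1 h2 h3 h4] hm] hq uq q0 hs hp; apply/negP => /andP[hx hy].
have pl : perm_eq ((z' :: b) ++ rev (rcons a z)) (c ++ q).
  by apply: perm_trans hp; perm_solve.
have [u1 a1] := splice_in h3 h4 uq hq (subseq_refl c) pl.
have := hm ((z' :: b) ++ rev (rcons a z)).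
rewrite /cycle_in cross_cycle // u1 a1 (perm_size pl) size_cat.
have -> : 2 < size c + size q by rewrite ltn_addr.
by move=> /(_ isT); case: (q) q0 => //= ? ? _; clear; lia.
Qed.

(** Charge an entry satisfying [P] to the consecutive pair it ends and one satisfying [Q] to the
    pair it starts. Each of the [size g] pairs is charged at most once; the first and last entries
    are left over. *)
Lemma count_no_cross (P Q : pred T) a g :
  (forall s z z' t, a :: g = rcons s z ++ z' :: t -> ~~ (P z' && Q z)) ->
  count P (a :: g) + count Q (a :: g) <= size g + P a + Q (last a g).
Proof.
elim: g a => [|b g IH] a h /=; first by clear; lia.
have /(_ _)/= := IH b; have /= := h [::] a b g erefl.
move=> h1 h2; have {}h2 : count P (b :: g) + count Q (b :: g) <= size g + P b + Q (last b g).
  by apply: h2 => s z z' t E; apply: (h (a :: s) z z' t); rewrite E.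
by move: h1 h2; rewrite /=; clear; case: (P b); case: (Q a); case: (Q (last b g)) => /=; lia.
Qed.

(* x :: s1 ++ v :: rev (p :: q) ++ u :: rev (y :: s2) is a path through all of c and
   some outside vertices, so its ends cannot have crossing neighbours. *)
Lemma succ_degree_sum U u x s1 v y s2 p q :
  let c := u :: x :: s1 ++ v :: y :: s2 in
  longest_cycle U c -> path_off U c p q -> e u p -> e (last p q) v ->
  count (e x) c + count (e y) c <= size c.
Proof.
move=> c lc pq eup eqv.
have [q' [pq' lq' sq' Eq']] := path_off_rev pq.
have [/and4P[_ hc _ _] _] := lc.
have [hp1 hp2 hp3] := and3P pq'; rewrite Eq' in hp2 hp3.
have hW : sorted e (x :: s1 ++ v :: rev (p :: q) ++ u :: rev (y :: s2)).
  move: hc; rewrite /c /= rcons_cat cat_path /= rcons_path => /and4P[exu h1 h2 /and3P[evy h3 h4]].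
  rewrite cat_path h1 /= h2 -Eq' /= cat_path hp1 lq' e_sym eqv /= e_sym eup /=.
  have : path e u (rev (y :: s2)).
    have : path e y (rcons s2 u) by rewrite rcons_path h3 h4.
    by rewrite rev_path_sym last_rcons belast_rcons.
  by [].
have nc s z z' t : x :: s1 ++ v :: rev (p :: q) ++ u :: rev (y :: s2) = rcons s z ++ z' :: t ->
   ~~ (e x z' && e y z).
  move=> E; have -> : x = head z s by case: (s) E => [|? ?] [].
  have -> : y = last z' t.
    have := congr1 (last x) E; rewrite /= !last_cat /= !last_cat /=.
    by rewrite rev_cons last_rcons.
  apply: (longest_cycle_no_cross lc hp3 hp2); rewrite -?E //.
    by rewrite rev_cons; case: (rev q).
  by rewrite /c; perm_solve.
(* The long path meets the cycle in two segments, counted separately. The terms [e x x] and [e y y]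
   vanish, [e y v] and [e x u] are at most 1, and the total is at most [size c]. *)
have n1 : count (e x) (x :: s1 ++ [:: v]) + count (e y) (x :: s1 ++ [:: v])
   <= size (s1 ++ [:: v]) + e x x + e y (last x (s1 ++ [:: v])).
  apply: count_no_cross => s z z' t E.
  apply: (nc s z z' (t ++ rev (p :: q) ++ u :: rev (y :: s2))).
  by have := congr1 (cat^~ (rev (p :: q) ++ u :: rev (y :: s2))) E; rewrite /= -!catA.
have n2 : count (e x) (u :: rev (y :: s2)) + count (e y) (u :: rev (y :: s2))
   <= size (rev (y :: s2)) + e x u + e y (last u (rev (y :: s2))).
  apply: count_no_cross => s z z' t E.
  apply: (nc (x :: s1 ++ v :: rev (p :: q) ++ s) z z' t).
  by rewrite E rcons_cons rcons_cat rcons_cons rcons_cat /= -!catA /= -!catA.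
move: n1 n2; rewrite rev_cons last_rcons !e_irr /c /= !count_cat !size_cat /=.
rewrite -!cats1 !count_cat !count_rev !size_cat size_rev /= !e_irr.
move: (e y (last x (s1 ++ [:: v]))) (e x u) => b1 b2; clear; lia.
Qed.

(** * Paths to a target, cycles from longest paths, Dirac's bound *)

(** For [M] inside [H]: a union of components of the graph induced on [H]. *)
Definition closed_in (H M : {set T}) : Prop :=
  forall x y, x \in M -> y \in H -> e x y -> y \in M.

(* The Erdos-Gallai lemma on long paths between two vertices, with the target
   replaced by the set where [beta] is positive: it lies outside H, and [beta x]
   counts the edges from x to it. *)
Lemma path_to_target k (H : {set T}) u (beta : T -> nat) :
  u \notin H -> H != set0 ->
  (forall M : {set T}, M \subset H -> M != set0 -> closed_in H M ->
     exists2 x, x \in M & e u x) ->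
  (forall y (M : {set T}), y \in u |: H -> M \subset H :\ y -> M != set0 ->
     closed_in ((u |: H) :\ y) M -> exists2 x, x \in M & 0 < beta x) ->
  (forall x, x \in H -> k <= deg (u |: H) x + beta x) ->
  exists p, [/\ path e u p, uniq p, all (mem H) p, 0 < size p
    & 0 < beta (last u p) /\ k <= size p + beta (last u p)].
Proof.
have [n] := ubnP #|H|; elim: n => // n IH in k H u beta *.
rewrite ltnS => leHn uH H0 conn cut hdeg.
(* First case: [H] is disconnected, and a proper union [M] of components inherits the hypotheses. *)
have [[M [MH M0 MnH clM]]|nocl] := EM (exists M : {set T},
    [/\ M \subset H, M != set0, M != H & closed_in H M]).
  have MpH : M \proper H by rewrite properEneq MnH.
  have uM : u \notin M by apply: contra uH; apply: (subsetP MH).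
  have [|N NM N0 clN|y N yM NM N0 clN|x xM|p [h1 h2 h3 h4 h5]] := IH k M u beta _ uM M0.
  - exact: leq_trans (proper_card MpH) leHn.
  - apply: conn N0 _; first exact: subset_trans MH.
    by move=> x z xN zH exz; apply: (clN x) => //; apply: (clM x) => //; apply: (subsetP NM).
  - apply: (cut y N _ _ N0).
    + by move: yM; rewrite !inE => /orP[->//|/(subsetP MH) ->]; rewrite orbT.
    + by apply: subset_trans NM _; apply: setSD.
    + move=> x z xN; rewrite !inE => /andP[zy zH] exz; apply: (clN x z xN) => //.
      rewrite !inE zy /=; case/orP: zH => [->//|zH]; apply/orP; right; apply: (clM x) => //.
      by move/(subsetP NM): xN; rewrite inE => /andP[].
  - apply: leq_trans (hdeg x (subsetP MH x xM)) _; rewrite leq_add2r.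
    apply: subset_leq_card; apply/subsetP => z; rewrite !inE => /andP[exz /orP[->|zH]].
      by rewrite exz.
    by rewrite exz (clM x) // orbT.
  - exists p; split=> //; apply: sub_all h3 => x; exact: (subsetP MH).
(* Second case: some [y] in [H] cuts off a set [M] on which [beta] vanishes. Induction on [M] aims
   at [y], and the path continues from [y] outside [M] to the target. *)
have [[y [M [yH MH M0 clM nW]]]|nocut] := EM (exists y (M : {set T}),
    [/\ y \in H, M \subset H :\ y, M != set0, closed_in (H :\ y) M
      & forall x, x \in M -> beta x = 0]).
  have sMH : M \subset H by apply: subset_trans MH (subD1set _ _).
  have yM : y \notin M by apply/negP => /(subsetP MH); rewrite !inE eqxx.
  have MpH : M \proper H by rewrite properE sMH; apply/subsetPn; exists y.
  have uM : u \notin M by apply: contra uH; apply: (subsetP sMH).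
  have [|N NM N0 clN|y' N yM' NM N0 clN|x xM|p [h1 h2 h3 h4 [h5 h6]]] :=
      IH k M u (fun x => nat_of_bool (e x y)) _ uM M0.
  - exact: leq_trans (proper_card MpH) leHn.
  - have [//|nu] := EM (exists2 x, x \in N & e u x).
    have [|||x xN] := cut y N _ _ N0; last by rewrite nW // (subsetP NM).
    + by rewrite !inE yH orbT.
    + by apply/subsetP => x /(subsetP NM) xM; apply: (subsetP MH).
    + move=> x z xN; rewrite !inE => /andP[zy /orP[/eqP ->|zH]] exz.
        by case: nu; exists x => //; rewrite e_sym.
      by apply: (clN x) => //; apply: (clM x) => //; [apply: (subsetP NM)|rewrite !inE zy].
  - have [//|nu] := EM (exists2 x, x \in N & 0 < e x y).
    have sNM x : x \in N -> x \in M by move/(subsetP NM); rewrite inE => /andP[].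
    have [|||x xN] := cut y' N _ _ N0; last by rewrite nW // sNM.
    + by move: yM'; rewrite !inE => /orP[->//|/(subsetP sMH) ->]; rewrite orbT.
    + by apply: subset_trans NM _; apply: setSD.
    + move=> x z xN; rewrite !inE => /andP[zy' zH] exz; apply: (clN x z xN) => //.
      rewrite !inE zy' /=; case/orP: zH => [->//|zH]; apply/orP; right.
      apply: (clM x) => //; first exact: sNM.
      by rewrite !inE zH andbT; apply/eqP => zy; case: nu; exists x; rewrite // -zy exz.
  - have := hdeg x (subsetP sMH x xM); rewrite nW // addn0 => /leq_trans; apply.
    rewrite /deg; apply: leq_trans (_ : #|(nbr x :&: (u |: M)) :|: (nbr x :&: [set y])| <= _).
      apply: subset_leq_card; apply/subsetP => z; rewrite !inE => /andP[exz /orP[->|zH]].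
        by rewrite exz.
      rewrite exz /=; have [->|zy] := eqVneq z y; first by rewrite orbT.
      by rewrite (clM x) ?orbT // !inE zy.
    apply: leq_trans (leq_card_setU _ _) _; rewrite leq_add2l.
    case exy: (e x y); first by apply: leq_trans (subset_leq_card (subsetIr _ _)) _; rewrite cards1.
    by rewrite (_ : _ :&: _ = set0) ?cards0 //; apply/setP => z; rewrite !inE andbC;
       case: eqP => // ->.
  - pose r a b := e a b && (b \in H :\: M).
    have hpM x : x \in p -> x \in M by move/(allP h3).
    have [w wN wb] : exists2 w, connect r y w & (0 < beta w).
      pose N := [set z in H :\: M | connect r y z].
      (* Otherwise [M :|: N] would be a proper closed subset of [H], as in the first case. *)
      have MN : M :|: N = H.
        apply/eqP; apply/negPn/negP => MNH; case: nocl; exists (M :|: N); split=> //.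
        - apply/subsetP => z; rewrite !inE => /orP[/(subsetP sMH)//|/andP[/andP[]]//].
        - by case/set0Pn: M0 => z zM; apply/set0Pn; exists z; rewrite inE zM.
        move=> a b aMN bH eab; have [bM|bM] := boolP (b \in M); first by rewrite inE bM.
        rewrite inE (negbTE bM) /= !inE bM bH /=.
        move: aMN; rewrite inE => /orP[aM|]; last first.
          rewrite !inE => /andP[_ cya]; apply: connect_trans cya _; apply: connect1.
          by rewrite /r eab inE bM bH.
        have [->|by_] := eqVneq b y; first exact: connect0.
        by move: bM; rewrite (clM a) // !inE by_.
      have [|||w] := cut u H _ _ H0.
      - by rewrite !inE eqxx.
      - by apply/subsetP => z zH; rewrite !inE zH andbT; apply: contraNneq uH => <-.
      - by move=> a b _; rewrite !inE => /andP[/negbTE -> /=].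
      rewrite -MN inE => /orP[wM|]; first by rewrite nW.
      by rewrite inE => /andP[_ cw] bw; exists w.
    case/connectP: wN wb => p2 hp2 ->; case/shortenP: hp2 => p3 hp3 up3 _ wb.
    have a3 : all (mem (H :\: M)) (y :: p3).
      have hr s a : path r a s -> all (mem (H :\: M)) s.
        by elim: s a => //= b s IHs a /andP[/andP[_ ->]] /IHs ->.
      by rewrite /= (hr _ _ hp3) inE yM yH.
    exists (p ++ y :: p3); split.
    + rewrite cat_path h1 /=; move: h5; case: (e _ y) => //= _.
      by apply: sub_path hp3 => a b /andP[].
    + rewrite cat_uniq h2 up3 andbT; apply/hasPn => z /(allP a3) /=.
      by rewrite inE => /andP[zM _]; apply: contra zM => /hpM.
    + rewrite all_cat; apply/andP; split; first by apply/allP => z /hpM /(subsetP sMH).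
      by apply: sub_all a3 => z /=; rewrite inE => /andP[].
    + by rewrite size_cat /= addnS.
    rewrite last_cat /=; split=> //; rewrite size_cat /=.
    move: h6 wb; move: (beta _) => b; case: (e _ y) => /=; clear; lia.
(* Third case: step from [u] to a neighbour [z] and continue in [H :\ z]. Only [u] leaves the
   ambient set, so degrees drop by at most one, which the extra vertex of the path compensates. *)
have [z zH euz] := conn H (subxx _) H0 (fun x y _ yH _ => yH).
have [bz|Hz] := eqVneq H [set z].
  exists [:: z]; rewrite /= euz zH; split=> //.
  have [|||w] := cut u H _ _ H0.
  - by rewrite !inE eqxx.
  - by apply/subsetP => a aH; rewrite !inE aH andbT; apply: contraNneq uH => <-.
  - by move=> a b _; rewrite !inE => /andP[/negbTE -> /=].
  rewrite bz inE => /eqP -> bw; split=> //; apply: leq_trans (hdeg z zH) _.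
  rewrite leq_add2r; apply: leq_trans (_ : #|[set u]| <= 1); last by rewrite cards1.
  apply: subset_leq_card; apply/subsetP => a; rewrite bz !inE => /andP[eza /orP[//|/eqP az]].
  by move: eza; rewrite az e_irr.
have [|||M MH M0 clM|y M yH MH M0 clM|x xH|p [h1 h2 h3 h4 [h5 h6]]] :=
    IH k.-1 (H :\ z) z beta.
- by move: leHn; rewrite (cardsD1 z) zH.
- by rewrite !inE eqxx.
- by apply: contra Hz => /eqP Hz0; rewrite -(setD1K zH) Hz0 setU0.
- have [//|nz] := EM (exists2 x, x \in M & e z x).
  case: nocl; exists M; split=> //.
  + exact: subset_trans MH (subD1set _ _).
  + by apply: contraTneq zH => <-; apply/negP => /(subsetP MH); rewrite !inE eqxx.
  move=> a b aM bH eab; have [bz|bz] := eqVneq b z; last by apply: (clM a) => //; rewrite !inE bz.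
  by case: nz; exists a; rewrite // e_sym -bz.
- have [//|nw] := EM (exists2 x, x \in M & 0 < beta x).
  case: nocut; exists y, M; split=> //.
  + by move: yH; rewrite setD1K.
  + by apply: subset_trans MH _; apply: setSD; apply: subD1set.
  + by move: clM; rewrite setD1K.
  + by move=> x xM; apply/eqP; rewrite -leqn0 leqNgt; apply/negP => bx; case: nw; exists x.
- move: xH; rewrite inE => /andP[_ xH]; have := hdeg x xH; rewrite setD1K //.
  have : deg (u |: H) x <= (deg H x).+1.
    rewrite /deg setIUr; apply: leq_trans (leq_card_setU _ _) _; rewrite addnC -addn1 leq_add2l.
    by apply: leq_trans (subset_leq_card (subsetIr _ _)) _; rewrite cards1.
  by move: (deg _ _) (deg _ _) (beta x) => a b c; clear; lia.
exists (z :: p); split=> //=.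
- by rewrite euz.
- by rewrite h2 andbT; apply/negP => /(allP h3) /=; rewrite !inE eqxx.
- by rewrite zH /=; apply: sub_all h3 => a /=; rewrite inE => /andP[].
by split=> //; move: h6; move: (beta _) => b; clear; lia.
Qed.

Lemma longest_seq (P : seq T -> Prop) : (forall s, P s -> uniq s) -> (exists s, P s) ->
  exists2 s, P s & forall s', P s' -> size s' <= size s.
Proof.
move=> uP [s0 Ps0].
have ex : exists n, `[< exists2 s, P s & size s = n >].
  by exists (size s0); apply/asboolP; exists s0.
have ub n : `[< exists2 s, P s & size s = n >] -> n <= #|T|.
  move=> /asboolP[s /uP us <-]; rewrite -(card_uniqP us); exact: max_card.
case: (ex_maxnP ex ub) => n /asboolP[s Ps <-] hmax; exists s => // s' Ps'.
by apply: hmax; apply/asboolP; exists s'.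
Qed.

Lemma longest_path (U : {set T}) : U != set0 -> exists x q,
  [/\ [&& path e x q, uniq (x :: q) & all (mem U) (x :: q)],
      forall y, y \in U -> e x y -> y \in q,
      forall y, y \in U -> e (last x q) y -> y \in belast x q &
      forall x' q', [&& path e x' q', uniq (x' :: q') & all (mem U) (x' :: q')] ->
        size q' <= size q].
Proof.
move=> /set0Pn[x0 x0U].
pose P s := if s is x :: q then [&& path e x q, uniq (x :: q) & all (mem U) (x :: q)] else false.
have [|| [//|x q] Pq hmax] := @longest_seq P.
- by case=> // x q /and3P[].
- by exists [:: x0]; rewrite /= x0U.
exists x, q; split=> //; last first.
- by move=> x' q' h; have := hmax (x' :: q') h.
- move=> y yU ely; apply/negPn/negP => yN.
  have yq : y \notin x :: q.
    rewrite lastI mem_rcons inE negb_or yN andbT.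
    by apply: contraTneq ely => ->; rewrite e_irr.
  have /hmax : P (x :: rcons q y).
    case/and3P: Pq => h1 h2 h3; rewrite /P rcons_path h1 ely.
    by rewrite -rcons_cons rcons_uniq yq h2 all_rcons h3 /= yU.
  by rewrite /= size_rcons ltnn.
- move=> y yU exy; apply/negPn/negP => yN.
  have /hmax : P (y :: x :: q).
    case/and3P: Pq => h1 h2 h3; apply/and3P; split.
    - by rewrite /= e_sym exy.
    - rewrite cons_uniq h2 andbT inE negb_or yN andbT.
      by apply: contraTneq exy => ->; rewrite e_irr.
    - by apply/andP.
  by rewrite /= ltnn.
Qed.

Lemma last_has (P : pred T) q : has P q ->
  exists s1 y s2, [/\ q = s1 ++ y :: s2, P y & ~~ has P s2].
Proof.
elim: q => //= a q IH; case: (boolP (has P q)) => [/IH[s1 [y [s2 [-> Py n2]]]] _|nq].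
  by exists (a :: s1), y, s2.
by rewrite orbF => Pa; exists [::], a, q.
Qed.

(** All neighbours of an end [x] of a longest path lie on that path; closing it at the last of them
    gives the cycle. *)
Lemma cycle_through_nbrs (U : {set T}) : U != set0 -> (forall x, x \in U -> 2 <= deg U x) ->
  exists x c, [/\ cycle_in U c, x \in c & nbr x :&: U \subset c].
Proof.
move=> U0 hdeg; have [x [q [/and3P[hp hu ha] hx _ _]]] := longest_path U0.
have xU : x \in U by move: ha => /andP[].
have d2 := hdeg x xU.
have hq : has (e x) q.
  have /card_gt0P[y] : 0 < deg U x by apply: leq_trans d2.
  rewrite !inE => /andP[exy yU]; apply/hasP; exists y => //; exact: hx.
have [s1 [y [s2 [Eq exy n2]]]] := last_has hq.
have sub : nbr x :&: U \subset rcons s1 y.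
  apply/subsetP => z; rewrite !inE => /andP[exz zU]; have := hx z zU exz.
  rewrite Eq mem_cat mem_rcons !inE => /or3P[->|->|zs]; rewrite ?orbT //.
  by case/hasP: n2; exists z.
exists x, (x :: rcons s1 y); split; last first.
- by apply: subset_trans sub _; apply/subsetP => z; rewrite inE orbC => ->.
- exact: mem_head.
rewrite /cycle_in; apply/and4P; split.
- rewrite /= ltnS; apply: leq_trans d2 _; apply: leq_trans (subset_leq_card sub) _.
  exact: card_size.
- by move: hp; rewrite Eq -cat_rcons cat_path /= [in X in _ -> X]rcons_path last_rcons => /andP[-> _]; rewrite e_sym.
- by move: hu; rewrite Eq -cat_rcons -cat_cons cat_uniq => /andP[].
- by move: ha; rewrite Eq -cat_rcons -cat_cons all_cat => /andP[].
Qed.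

(** The chord condition in terms of degrees: fewer than [k] chords plus the two cyclic neighbours
    amount to [K = k + 1]. *)
Definition cycle_degree_bounded (K : nat) : Prop :=
  forall c v, cycle_in setT c -> v \in c -> deg [set y in c] v <= K.

Lemma cycle_inT U c : cycle_in U c -> cycle_in setT c.
Proof.
by case/and4P=> h1 h2 h3 _; rewrite /cycle_in h1 h2 h3; apply/allP => y; rewrite inE.
Qed.

Lemma min_degree_le K (U : {set T}) : 0 < K -> cycle_degree_bounded K -> U != set0 ->
  exists2 v, v \in U & deg U v <= K.
Proof.
move=> K0 hK U0; have [//|hn] := EM (exists2 v, v \in U & deg U v <= K).
have hd x : x \in U -> K < deg U x.
  by move=> xU; rewrite ltnNge; apply/negP => h; case: hn; exists x.
have [|x [c [hc xc sub]]] := cycle_through_nbrs U0.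
  by move=> x /hd; apply: leq_ltn_trans.
have xU : x \in U by case/and4P: hc => _ _ _ /allP /(_ x xc).
exists x => //; apply: leq_trans (hK c x (cycle_inT hc) xc); apply: subset_leq_card.
by apply/subsetP => y yN; move: (yN); rewrite !inE (subsetP sub _ yN) => /andP[->].
Qed.

Lemma longest_cycle_exists (U : {set T}) : U != set0 -> (forall x, x \in U -> 2 <= deg U x) ->
  exists c, longest_cycle U c.
Proof.
move=> U0 hd; have [||c h1 h2] := @longest_seq (cycle_in U); last by exists c.
- by move=> s /and4P[].
- by have [x [c [hc _ _]]] := cycle_through_nbrs U0 hd; exists c.
Qed.

(* No vertex y (inside or outside U) cuts off M from the rest of U. *)
Definition nonseparable (U : {set T}) : Prop := forall y (M : {set T}),
  M \subset U :\ y -> M != set0 -> closed_in (U :\ y) M -> U \subset y |: M.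

(* Dirac's theorem. *)
Lemma longest_cycle_min_degree d (U : {set T}) c : nonseparable U -> longest_cycle U c ->
  ~~ (U \subset c) -> (forall x, x \in U -> d <= deg U x) -> 2 * d <= size c.
Proof.
move=> ns lc /subsetPn[v vU vc] hd.
have [/and4P[c2 _ uc /allP aU] _] := lc.
pose R := U :\: [set z in c].
pose P (M : {set T}) := [&& M != set0, M \subset R & `[< closed_in R M >]].
have PR : P R.
  rewrite /P subxx /=; apply/andP; split; last by apply/asboolP => ? ? _ ? _.
  by apply/set0Pn; exists v; rewrite !inE vc.
(* [D] is a component of the part off the cycle, obtained as a minimal nonempty closed set. *)
have [D /minsetP[/and3P[D0 DR /asboolP clD] minD] _] := minset_exists PR.
have DU x : x \in D -> (x \in U) && (x \notin c).
  by move/(subsetP DR); rewrite !inE andbC.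
have cD x : x \in c -> x \notin D by move=> xc; apply/negP => /DU; rewrite xc andbF.
have c_other y : exists2 z, z \in c & z != y.
  case: (c) c2 uc => [//|a [//|b c']] _ /= /andP[]; rewrite !inE negb_or => /andP[ab _] _.
  have [ay|ay] := eqVneq a y; last by exists a; rewrite ?inE ?eqxx.
  by exists b; rewrite ?inE ?eqxx ?orbT // eq_sym -ay.
have ns' y (M : {set T}) : M \subset D -> M != set0 -> y \notin M ->
    exists x z, [/\ x \in M, z \in U, z != y, e x z & z \notin M].
  move=> MD M0 yM; have [//|hn] := EM (exists x z, [/\ x \in M, z \in U, z != y, e x z & z \notin M]).
  have /subsetP h : U \subset y |: M.
    apply: ns M0 _; first by apply/subsetP => x xM; rewrite !inE; case/andP: (DU x (subsetP MD x xM)) => -> _;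
      rewrite andbT; apply: contraNneq yM => <-.
    move=> x z xM; rewrite !inE => /andP[zy zU] exz; apply/negPn/negP => zM.
    by case: hn; exists x, z.
  have [z zc zy] := c_other y; have := h z (aU z zc).
  by rewrite !inE (negbTE zy) /= => /(subsetP MD); rewrite (negbTE (cD _ zc)).
have [y0 y0c _] := c_other v.
have [d0 [u [d0D uU _ ed0u uD]]] := ns' y0 D (subxx _) D0 (cD _ y0c).
have uc' : u \in c by apply: contraR uD => uc'; apply: (clD d0) => //; rewrite !inE uc'.
(* The target is the cycle without [u], so that a path leaving the cycle at [u] returns
   elsewhere. *)
pose beta x := #|nbr x :&: ([set z in c] :\ u)|.
have beta_gt0 x z : z \in c -> z != u -> e x z -> 0 < beta x.
  by move=> zc zu exz; apply/card_gt0P; exists z; rewrite !inE exz zc zu.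
have clMD (M : {set T}) : M \subset D -> M != set0 -> closed_in D M -> M = D.
  move=> MD M0 clM; apply: minD => //; rewrite /P M0 (subset_trans MD DR); apply/asboolP.
  by move=> x y xM yR exy; apply: (clM x) => //; apply: (clD x) => //; apply: (subsetP MD).
have [M MD M0 clM|y M yuD MD M0 clM|x xD|p [hp up /allP pD p0 [bw hw]]] :=
    @path_to_target d D u beta uD D0.
- by rewrite (clMD M) //; exists d0; rewrite // e_sym.
- have sMD : M \subset D by apply: subset_trans MD (subD1set _ _).
  have yM : y \notin M by apply/negP => /(subsetP MD); rewrite !inE eqxx.
  have [x [z [xM zU zy exz zM]]] := ns' y M sMD M0 yM.
  exists x => //; have xD := subsetP sMD x xM.
  have [zc|zc] := boolP (z \in c).
    apply: (beta_gt0 x z) => //; apply: contraNneq zM => zu.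
    by apply: (clM x) => //; rewrite !inE zy zu eqxx.
  have zD : z \in D by apply: (clD x) => //; rewrite !inE zc.
  by move: zM; rewrite (clM x) // !inE zy zD orbT.
- apply: leq_trans (hd x _) _; first by case/andP: (DU x xD).
  apply: leq_trans (leq_card_setU _ _); apply: subset_leq_card; apply/subsetP => z.
  rewrite !inE => /andP[exz zU]; rewrite exz /=; have [//|zu] := eqVneq z u.
  have [zc|zc] := boolP (z \in c); first by rewrite orbT.
  by rewrite (clD x) // !inE zc.
case: p hp up pD p0 bw hw => //= x q /andP[eux hp] uq pD _ bw hw.
have pq : path_off U c x q.
  rewrite /path_off hp [uniq _]uq; apply/allP => z /pD /=; exact: DU.
have [a1 a1Y] : exists a1, a1 \in nbr (last x q) :&: ([set z in c] :\ u) by apply/card_gt0P.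
(* Two mixed gaps and a union of [beta + 1] vertices give [2 (size q + 1 + beta) <= size c]. *)
have := @gap_bound U x q [set u] (nbr (last x q) :&: ([set z in c] :\ u)) _ _ c u a1 lc pq.
have -> : #|u |: (nbr (last x q) :&: ([set z in c] :\ u))| = (beta (last x q)).+1.
  by rewrite cardsU1 !inE eqxx /= !andbF.
have uNa : u != a1 by move: a1Y; rewrite !inE eq_sym => /and3P[].
rewrite a1Y set11 uNa; set mm := maxn _ _.
move=> h; have {}h : 2 * (beta (last x q)).+1 + mm <= size c.
  apply: h => //; [| exact: subsetIl | |].
  - by apply/subsetP => z; rewrite !inE => /eqP ->; rewrite e_sym.
  - by apply/subsetP => z; rewrite !inE => /eqP ->.
  - by apply/subsetP => z; rewrite !inE => /and3P[].
have h2 : size q * 2 <= mm by apply: leq_maxl.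
by move: h h2 hw; move: (beta _) (size q) (size c) mm; clear; lia.
Qed.

(** * Independence of the vertices off a longest cycle *)

(** [m] is the length of a longest path off the cycle, [b] and [b'] count the neighbours of its ends
    on the cycle, [s] and [t] are the sizes of the union and intersection of these neighbourhoods.
    The bounds on [k] and [n] force [m <= d - 3], hence more neighbours than the cycle has room
    for. *)
Lemma dominating_arith d b b' m k n s t : d <= m + b -> d <= m + b' -> 2 * d <= k -> n + 2 <= 3 * d ->
  m + 1 + k <= n -> 0 < m -> t <= b' -> t <= b -> s + t = b + b' ->
  2 * s + maxn (m * 2) (m * t) <= k -> False.
Proof.
move=> h1 h2 h3 h4 h5 h6 h7 h8 h9 h10.
have h11 : 2 * s + m * 2 <= k by apply: leq_trans h10; rewrite leq_add2l leq_maxl.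
have {h10} h12 : 2 * s + m * t <= k by apply: leq_trans h10; rewrite leq_add2l leq_maxr.
have [t2|t2] := leqP t 2; first by nia.
have [m1|m1] := leqP m 1; first by nia.
nia.
Qed.
(** [f] stands for the largest of [s] numbers with pairwise sums at most [N], and [S] for their sum.
    The other numbers are at most [N - f], which helps when [2 f > N]. *)
Lemma pair_arith s f N S: 2 <= s -> S <= f + (s - 1) * (N - f) -> S <= s * f -> f <= N -> 2 * S <= s * N.
Proof. move=> h1 h2 h3 h4. have [h|h] := leqP (2 * f) N; nia. Qed.

(** In a longest path of the complement of the cycle, the off-cycle neighbours of each end lie on
    the path, so there are at most [size q] of them. *)
Lemma path_off_of_edge d (U : {set T}) c x0 y0 : uniq c -> all (mem U) c ->
  (forall x, x \in U -> d <= deg U x) ->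
  x0 \in U :\: [set z in c] -> y0 \in U :\: [set z in c] -> e x0 y0 ->
  exists x q, [/\ path_off U c x q, 0 < size q, d <= size q + deg [set z in c] x,
    d <= size q + deg [set z in c] (last x q) & size q + 1 + size c <= #|U|].
Proof.
set C := [set z in c]; set R := U :\: C => uc aU hd x0R y0R exy.
have R0 : R != set0 by apply/set0Pn; exists x0.
have [x [q [/and3P[hp hu /allP ha] hx hl hmax]]] := longest_path R0.
have split_deg z : z \in U -> deg U z <= deg R z + deg C z.
  move=> zU; apply: leq_trans (leq_card_setU _ _); apply: subset_leq_card.
  by apply/subsetP => w; rewrite !inE => /andP[-> ->]; case: (w \in c); rewrite ?orbT.
have RU z : z \in R -> z \in U by rewrite inE => /andP[].
have xR : x \in R by apply: ha; apply: mem_head.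
have lR : last x q \in R by apply: ha; apply: mem_last.
exists x, q; split.
- rewrite /path_off hp hu; apply/allP => z /ha /=; by rewrite !inE andbC.
- apply: (hmax x0 [:: y0]); apply/and3P; split; first by rewrite /= exy.
    by rewrite /= inE andbT; apply: contraTneq exy => ->; rewrite e_irr.
  by rewrite /= x0R y0R.
- apply: leq_trans (hd x (RU _ xR)) _; apply: leq_trans (split_deg _ (RU _ xR)) _.
  rewrite leq_add2r; apply: leq_trans (card_size q); apply: subset_leq_card.
  by apply/subsetP => z; rewrite inE => /andP[]; rewrite inE => exz zR; apply: hx.
- apply: leq_trans (hd _ (RU _ lR)) _; apply: leq_trans (split_deg _ (RU _ lR)) _.
  rewrite leq_add2r -(size_belast x q); apply: leq_trans (card_size _); apply: subset_leq_card.
  by apply/subsetP => z; rewrite inE => /andP[]; rewrite inE => exz zR; apply: hl.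
have -> : size q + 1 + size c = size ((x :: q) ++ c) by rewrite size_cat /= addn1.
have u2 : uniq ((x :: q) ++ c).
  rewrite cat_uniq hu uc andbT; apply/hasPn => z zc; apply/negP => /ha.
  by rewrite !inE zc.
rewrite -(card_uniqP u2); apply: subset_leq_card; apply/subsetP => z.
by rewrite mem_cat => /orP[/ha /RU|/(allP aU)].
Qed.

(* Nash-Williams' theorem. *)
Lemma longest_cycle_dominating d U c : longest_cycle U c -> 2 * d <= size c ->
  (forall x, x \in U -> d <= deg U x) -> #|U| + 2 <= 3 * d ->
  {in U :\: [set z in c] &, forall x y, ~~ e x y}.
Proof.
move=> lc dc hd nd x0 y0 x0R y0R; apply/negP => exy.
have [/and4P[_ _ uc aU] _] := lc.
have [x [q [pq q0 d1 d2 hs]]] := path_off_of_edge uc aU hd x0R y0R exy.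
set C := [set z in c] in d1 d2 *.
have cC (Y : {set T}) : Y :&: C \subset c.
  by apply/subsetP => z; rewrite !inE => /andP[].
have hq : size q + 3 <= d.
  by move: dc nd hs; move: (size c) (size q) #|U| => k m n; clear; lia.
have [a1 a1Y] : exists a1, a1 \in nbr (last x q) :&: C.
  apply/card_gt0P; rewrite -/(deg C (last x q)).
  by move: d2 hq; move: (deg _ _) (size q) => b m; clear; lia.
have [a0 a0Y a01] : exists2 a0, a0 \in nbr x :&: C & a0 != a1.
  have : 0 < #|(nbr x :&: C) :\ a1|.
    have := cardsD1 a1 (nbr x :&: C); move: d1 hq; rewrite -/(deg C x).
    by move: (deg C x) #|_| (size q) => b b' m; clear; case: (_ \in _) => /=; lia.
  by case/card_gt0P => a0; rewrite in_setD1 => /andP[h1 h2]; exists a0.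
have := @gap_bound U x q (nbr x :&: C) (nbr (last x q) :&: C) (subsetIl _ _) (subsetIl _ _)
  c a0 a1 lc pq (cC _) (cC _) a0Y a1Y a01.
have := cardsUI (nbr x :&: C) (nbr (last x q) :&: C).
have := subset_leq_card (subsetIl (nbr x :&: C) (nbr (last x q) :&: C)).
have := subset_leq_card (subsetIr (nbr x :&: C) (nbr (last x q) :&: C)).
rewrite -/(deg C x) -/(deg C (last x q)) => h1 h2 h3 h4.
exact: (dominating_arith d1 d2 dc nd hs q0 h1 h2 h3 h4).
Qed.

(** * Degree sums *)

Definition degsum (U : {set T}) : nat := \sum_(x in U) deg U x.

Lemma degE U x : deg U x = \sum_(y in U) e x y.
Proof.
rewrite /deg -sum1_card big_mkcond [RHS]big_mkcond /=; apply: eq_bigr => y _.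
by rewrite !inE; case: (e x y); case: (y \in U).
Qed.

Lemma degsum_split (C U : {set T}) : C \subset U ->
  degsum U = degsum C + 2 * (\sum_(v in U :\: C) deg C v) + degsum (U :\: C).
Proof.
move=> CU; have UC : U :&: C = C by apply/setIidPr.
have hd x : deg U x = deg C x + deg (U :\: C) x.
  by rewrite !degE (big_setID C) /= UC.
rewrite /degsum (big_setID C) /= UC (eq_bigr _ (fun x _ => hd x)) big_split /=.
rewrite [in X in _ + X](eq_bigr _ (fun x _ => hd x)) big_split /=.
suff -> : \sum_(x in C) deg (U :\: C) x = \sum_(v in U :\: C) deg C v.
  by move: (bigop _ _ _) (bigop _ _ _) (bigop _ _ _) => a b c; clear; lia.
rewrite (eq_bigr _ (fun x _ => degE _ x)) exchange_big /=; apply: eq_bigr => y _.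
by rewrite degE; apply: eq_bigr => x _; rewrite e_sym.
Qed.

Lemma degsum_rem (U : {set T}) v : v \in U -> degsum U = degsum (U :\ v) + 2 * deg U v.
Proof.
move=> vU; rewrite (@degsum_split (U :\ v)) ?subD1set //.
have -> : U :\: (U :\ v) = [set v].
  by apply/setP => z; rewrite !inE negb_and negbK; case: eqP => [->|_]; rewrite ?vU //= andNb.
have dvv : deg (U :\ v) v = deg U v.
  by apply: eq_card => z; rewrite !inE; case: eqP => // ->; rewrite e_irr.
by rewrite big_set1 dvv /degsum big_set1 (degE [set v]) big_set1 e_irr addn0.
Qed.

Lemma degsum_even U : ~~ odd (degsum U).
Proof.
have [n] := ubnP #|U|; elim: n => // n IH in U *; rewrite ltnS => hU.
have [->|/set0Pn[v vU]] := eqVneq U set0; first by rewrite /degsum big_set0.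
rewrite (degsum_rem vU) oddD mul2n odd_double addbF IH //.
by move: hU; rewrite (cardsD1 v) vU.
Qed.

Lemma degsum_le (U : {set T}) K : (forall x, x \in U -> deg U x <= K) -> degsum U <= #|U| * K.
Proof. by move=> h; rewrite -sum_nat_const; apply: leq_sum. Qed.

Lemma degsum_le_complete U : degsum U <= #|U| * (#|U|).-1.
Proof.
apply: degsum_le => x xU; rewrite (cardsD1 x) xU /=; apply: subset_leq_card.
apply/subsetP => y; rewrite !inE => /andP[exy ->]; rewrite andbT.
by apply: contraTneq exy => ->; rewrite e_irr.
Qed.

(** [M] is joined to the rest of [U] only through [y], so every edge lies in one of the two
    parts. *)
Lemma degsum_separation (U M : {set T}) y : M \subset U :\ y -> closed_in (U :\ y) M ->
  degsum U <= degsum (U :&: (y |: M)) + degsum (U :\: M).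
Proof.
move=> MU clM; have sMU : M \subset U by apply: subset_trans MU (subD1set _ _).
have yM : y \notin M by apply/negP => /(subsetP MU); rewrite !inE eqxx.
have h1 x : x \in M -> deg U x = deg (U :&: (y |: M)) x.
  move=> xM; apply: eq_card => z; rewrite !inE; case exz: (e x z) => //=.
  case zU : (z \in U) => //=; case: eqP => //= /eqP zy; symmetry.
  by apply: (clM x) => //; rewrite !inE zy.
have h2 x : x \in U -> x != y -> x \notin M -> deg U x = deg (U :\: M) x.
  move=> xU xy xM; apply: eq_card => z; rewrite !inE; case exz: (e x z) => //=.
  case zU : (z \in U); rewrite ?andbF //= andbT; symmetry; apply: contra xM => zM.
  by apply: (clM z) => //; [rewrite !inE xy | rewrite e_sym].
have h3 : deg U y <= deg (U :&: (y |: M)) y + deg (U :\: M) y.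
  apply: leq_trans (leq_card_setU _ _); apply: subset_leq_card; apply/subsetP => z.
  by rewrite !inE => /andP[-> ->]; case: (z \in M); rewrite ?orbT.
rewrite {1}/degsum (big_setID M) /= (setIidPr sMU) (eq_bigr _ h1).
have [yU|yU] := boolP (y \in U); last first.
  have -> : U :&: (y |: M) = M.
    apply/setP => z; rewrite !inE; case: eqP => [->|_] /=; first by rewrite (negbTE yU) (negbTE yM).
    by case zM: (z \in M); rewrite ?andbF // (subsetP sMU).
  rewrite leq_add2l; apply: leq_sum => x; rewrite inE => /andP[xM xU].
  by rewrite h2 //; apply: contraNneq yU => <-.
have E : U :&: (y |: M) = y |: M.
  apply/setP => z; rewrite !inE; case: eqP => [->|_] /=; first by rewrite yU.
  by case zM: (z \in M); rewrite ?andbF // (subsetP sMU).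
rewrite E in h3 *.
have yUM : y \in U :\: M by rewrite inE yM yU.
rewrite /degsum (big_setU1 _ yM) /= (big_setD1 y yUM) [X in _ <= _ + X](big_setD1 y yUM) /=.
have : \sum_(x in (U :\: M) :\ y) deg U x = \sum_(x in (U :\: M) :\ y) deg (U :\: M) x.
  by apply: eq_bigr => x; rewrite !inE => /and3P[xy xM xU]; apply: h2.
move=> ->; move: h3; move: (deg U y) (deg _ y) (deg _ y) => a b b'.
by move: (bigop _ _ _) (bigop _ _ _) => r r'; clear; lia.
Qed.

Lemma sum_pair_bound (A : {set T}) (f : T -> nat) N : 2 <= #|A| ->
  {in A &, forall x y, x != y -> f x + f y <= N} -> 2 * \sum_(x in A) f x <= #|A| * N.
Proof.
move=> A2 hf; have /card_gt0P[a aA] : 0 < #|A| by apply: leq_trans A2.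
case: (arg_maxnP f aA) => x xA' hx; have xA : x \in A by [].
have /card_gt0P[y] : 0 < #|A :\ x| by move: A2; rewrite (cardsD1 x) xA.
rewrite !inE => /andP[yx yA]; have hxy := hf x y xA yA.
apply: (@pair_arith _ (f x)) => //.
- rewrite (bigD1 x) //= leq_add2l.
  apply: leq_trans (_ : \sum_(z in A | z != x) (N - f x) <= _).
    apply: leq_sum => z /andP[zA zx]; have := hf x z xA zA; rewrite eq_sym => /(_ zx).
    by move: (f x) (f z) => b c; clear; lia.
  rewrite (eq_bigl (mem (A :\ x))) => [|z]; last by rewrite !inE andbC.
  by rewrite sum_nat_const (cardsD1 x A) xA add1n subn1.
- by rewrite -sum_nat_const; apply: leq_sum.
- by move: hxy; rewrite eq_sym => /(_ yx); move: (f x) (f y) => b c; clear; lia.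
Qed.

Lemma deg_count (c : seq T) x : uniq c -> deg [set z in c] x = count (e x) c.
Proof.
move=> uc; rewrite -size_filter -(card_uniqP (filter_uniq _ uc)).
by apply: eq_card => z; rewrite !inE mem_filter.
Qed.

(** By [arc_bound], for the path and its reversal, both arcs between [u] and [v] have inner
    vertices; the successors are thus the [x] and [y] of [succ_degree_sum]. *)
Lemma deg_next_sum U (c : seq T) u v p q : longest_cycle U c -> u \in c -> v \in c -> u != v ->
  path_off U c p q -> e u p -> e (last p q) v ->
  deg [set z in c] (next c u) + deg [set z in c] (next c v) <= size c.
Proof.
move=> lc uc vc uv pq eup eqv.
have [/and4P[_ _ hu _] _] := lc.
have [i l El] := rot_to uc; have lc' := longest_cycle_rot i lc.
have vl : v \in l by move: vc; rewrite -(mem_rot i) El inE eq_sym (negbTE uv).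
case/splitPr: vl El => l1 l2 El; rewrite El in lc'.
have pq' : path_off U (u :: l1 ++ v :: l2) p q.
  by apply: path_off_perm pq; rewrite -El perm_sym perm_rot.
have := arc_bound lc' pq' eup eqv.
case: l1 El lc' pq' => // x s1 El lc' pq' _.
have lc2 := longest_cycle_rot (size (u :: x :: s1)) lc'.
rewrite -cat_cons rot_size_cat in lc2.
have pq2 : path_off U (v :: l2 ++ u :: x :: s1) p q.
  by apply: path_off_perm pq'; perm_solve.
have [q' [pq3 lq' sq' _]] := path_off_rev pq2.
have := arc_bound lc2 pq3; rewrite lq' [e v _]e_sym [e p _]e_sym => /(_ eqv eup).
case: l2 El lc' pq' lc2 pq2 pq3 => // y s2 El lc' pq' lc2 pq2 pq3 _.
have nu : next c u = x by rewrite -(next_rot i hu) El /= eqxx.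
have ul : uniq (u :: x :: s1 ++ v :: y :: s2) by case: lc' => /and4P[].
have nv : next c v = y.
  rewrite -(next_rot i hu) El -(next_rot (size (u :: x :: s1)) ul) -[_ :: x :: _ ++ _]/((u :: x :: s1) ++ _).
  by rewrite rot_size_cat /= eqxx.
rewrite nu nv.
have Ec : [set z in c] = [set z in u :: x :: s1 ++ v :: y :: s2].
  by apply/setP => z; rewrite !in_set -(mem_rot i) El.
rewrite Ec !deg_count // -(size_rot i) El.
exact: (succ_degree_sum lc' pq' eup eqv).
Qed.

Lemma degsum_cycle K U c : cycle_degree_bounded K -> cycle_in U c ->
  degsum [set z in c] <= size c * K.
Proof.
move=> hK hc; have [_ _ uc _] := and4P hc; rewrite -(card_uniqP uc) -cardsE.
by apply: degsum_le => x; rewrite inE => xc; apply: hK => //; apply: cycle_inT hc.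
Qed.

(** The successors of [A] have pairwise degree sums at most [size c], hence at most half of that on
    average; the other vertices of the cycle have degree at most [K]. *)
Lemma degsum_cycle_succ K U c (A : {set T}) : cycle_degree_bounded K -> longest_cycle U c ->
  A \subset c -> 2 <= #|A| ->
  {in A &, forall u v, u != v -> exists p q, [/\ path_off U c p q, e u p & e (last p q) v]} ->
  2 * degsum [set z in c] <= 2 * (size c - #|A|) * K + #|A| * size c.
Proof.
move=> hK lc Ac A2 hA; have [hc _] := lc; have [_ _ uc _] := and4P hc.
pose B := next c @: A.
have ninj : injective (next c) by apply: can_inj (prev_next uc).
have cB : #|B| = #|A| by apply: card_imset.
have BC : B \subset [set z in c].
  by apply/subsetP => _ /imsetP[a aA ->]; rewrite inE mem_next (subsetP Ac).
have h1 : 2 * \sum_(x in B) deg [set z in c] x <= #|B| * size c.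
  apply: sum_pair_bound; first by rewrite cB.
  move=> _ _ /imsetP[u uA ->] /imsetP[v vA ->] nuv.
  have uv : u != v by apply: contraNneq nuv => ->.
  have [p [q [pq eup eqv]]] := hA u v uA vA uv.
  by apply: (deg_next_sum lc _ _ uv pq eup eqv); apply: (subsetP Ac).
have h2 : \sum_(x in [set z in c] :\: B) deg [set z in c] x <= (size c - #|A|) * K.
  rewrite -(card_uniqP uc) -cB -[#|c|]cardsE.
  have <- : #|[set z in c] :\: B| = #|[set z in c]| - #|B| by rewrite cardsD (setIidPr BC).
  rewrite -sum_nat_const; apply: leq_sum => x; rewrite !inE => /andP[_ xc].
  by apply: hK => //; apply: cycle_inT hc.
rewrite /degsum (big_setID B) /= (setIidPr BC).
by rewrite cB in h1; move: h1 h2; move: (bigop _ _ _) (bigop _ _ _) => a b; clear; lia.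
Qed.

(** [v] and the arc of [c] from a member [a0] of [A] to the last member [a1] after it form a cycle
    containing all of [A]. *)
Lemma off_vertex_degree_le K U c v (A : {set T}) : cycle_degree_bounded K -> longest_cycle U c ->
  v \notin c -> A \subset c -> A \subset nbr v -> 2 <= #|A| -> #|A| <= K.
Proof.
move=> hK [hc _] vc Ac Av A2.
have [a0 a0A] : exists a0, a0 \in A by apply/card_gt0P; apply: leq_trans A2.
have a0c := subsetP Ac _ a0A.
have [i l El] := rot_to a0c.
have ml z : (z \in c) = (z \in a0 :: l) by rewrite -El mem_rot.
have hl : has (mem A) l.
  have /card_gt0P[a1] : 0 < #|A :\ a0| by move: A2; rewrite (cardsD1 a0) a0A.
  rewrite in_setD1 => /andP[a10 a1A]; apply/hasP; exists a1 => //.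
  by have := subsetP Ac _ a1A; rewrite ml inE (negbTE a10).
have [l1 [a1 [l2 [E2 a1A n2]]]] := last_has hl.
have ev z : z \in A -> e v z by move/(subsetP Av); rewrite inE.
have [_ hcyc uc _] := and4P hc.
have hcyc' : cycle e (a0 :: l) by rewrite -El rot_cycle.
have uc' : uniq (a0 :: l) by rewrite -El rot_uniq.
have Asub : A \subset v :: a0 :: rcons l1 a1.
  apply/subsetP => z zA; have := subsetP Ac _ zA; rewrite ml E2 !inE mem_cat mem_rcons !inE.
  move=> /or4P[->|->|->|zl2]; rewrite ?orbT //.
  by case/hasP: n2; exists z.
have hcv : cycle_in setT (v :: a0 :: rcons l1 a1).
  apply/and4P; split.
  - by rewrite /= size_rcons.
  - move: hcyc'; rewrite E2 -cat_rcons /= rcons_cat cat_path => /andP[h1 _].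
    by rewrite rcons_path last_rcons h1 ev // e_sym ev.
  - have : uniq (a0 :: rcons l1 a1) by move: uc'; rewrite E2 -cat_rcons -cat_cons cat_uniq => /andP[].
    rewrite cons_uniq => ->; rewrite andbT; apply: contra vc.
    by move=> h; rewrite ml E2 -cat_rcons -cat_cons mem_cat h.
  - by apply/allP => z _ /=; rewrite inE.
apply: leq_trans (hK _ _ hcv (mem_head _ _)); apply: subset_leq_card.
apply/subsetP => z zA; rewrite in_setI (subsetP Av) //= in_set; exact: (subsetP Asub).
Qed.

Lemma dominating_cycle_bounds K U c v : cycle_degree_bounded K -> longest_cycle U c ->
  {in U :\: [set z in c] &, forall x y, ~~ e x y} -> v \in U :\: [set z in c] ->
  (forall w, w \in U :\: [set z in c] -> deg U w <= deg U v) -> 2 <= deg U v ->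
  [/\ deg U v <= K, 2 * deg U v <= size c, size c < #|U|,
    2 * degsum U <= 2 * (size c - deg U v) * K + deg U v * size c
                    + 4 * (#|U| - size c) * deg U v
    & degsum U <= size c * K + 2 * (#|U| - size c) * deg U v].
Proof.
set C := [set z in c] => hK lc indR vR hmax s2.
have [hc _] := lc; have [_ _ uc /allP aU] := and4P hc.
have CU : C \subset U by apply/subsetP => z; rewrite inE => /aU.
have cC : #|C| = size c by rewrite cardsE (card_uniqP uc).
have degC w : w \in U :\: C -> deg U w = deg C w.
  move=> wR; apply: eq_card => z; rewrite !inE; case ewz: (e w z) => //=.
  apply/idP/idP => [zU|zc]; last exact: aU.
  by apply/negPn/negP => zc; have := indR w z wR; rewrite ewz !inE zc zU => /(_ isT).
pose A := nbr v :&: C; have cA : #|A| = deg U v by rewrite degC.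
have vc : v \notin c by move: vR; rewrite !inE => /andP[].
have vU : v \in U by move: vR; rewrite !inE => /andP[].
have Ac : A \subset c by apply/subsetP => z; rewrite !inE => /andP[].
have pv : path_off U c v [::] by rewrite /path_off /= vU vc.
have eA z : z \in A -> e v z by rewrite !inE => /andP[].
have s2' : 2 <= #|A| by rewrite cA.
have hR : #|U :\: C| = #|U| - size c by rewrite cardsD (setIidPr CU) cC.
have hS : degsum U = degsum C + 2 * \sum_(w in U :\: C) deg C w.
  rewrite (degsum_split CU) [X in _ + X](_ : _ = 0) ?addn0 //.
  apply: big1 => x xR; rewrite degE; apply: big1 => y yR.
  by rewrite (negbTE (indR x y xR yR)).
have hS2 : \sum_(w in U :\: C) deg C w <= (#|U| - size c) * deg U v.
  rewrite -hR -sum_nat_const; apply: leq_sum => w wR.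
  by rewrite -degC ?hmax.
split.
- by rewrite -cA; apply: (off_vertex_degree_le hK lc vc Ac _ s2'); apply: subsetIl.
- have [a0 a0A] : exists a0, a0 \in A by apply/card_gt0P; apply: leq_trans s2'.
  have /card_gt0P[a1] : 0 < #|A :\ a0| by move: s2'; rewrite (cardsD1 a0) a0A.
  rewrite in_setD1 => /andP[a10 a1A].
  (* The trivial path at [v] has length 0, so only the term [2 * #|A|] survives. *)
  have := @gap_bound U v [::] A A (subsetIl _ _) (subsetIl _ _) c a1 a0 lc pv Ac Ac a1A a0A a10.
  by rewrite setUid cA /= max0n addn0.
- rewrite -cC; apply: proper_card; rewrite properE CU; apply/subsetPn; exists v => //.
  by rewrite inE.
- have hsucc := degsum_cycle_succ hK lc Ac s2'.
  have : 2 * degsum C <= 2 * (size c - deg U v) * K + deg U v * size c.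
    rewrite -cA; apply: hsucc => a b aA bA _; exists v, [::]; split=> //=; last exact: eA.
    by rewrite e_sym eA.
  rewrite hS -!mulnA; move: hS2; move: (degsum C) (bigop _ _ _) => a b.
  by move: (_ * deg U v) (_ * K) (_ * size c) => m k l; clear; lia.
- have := degsum_cycle hK hc; rewrite -/C hS -!mulnA; move: hS2.
  by move: (degsum C) (bigop _ _ _) (_ * deg U v) (_ * K) => a b m k; clear; lia.
Qed.

(** [tau] is abstract because [K = 3] and [K = 4] use another function than larger [K]. The
    hypotheses on [tau] serve, in order, a Hamiltonian cycle, degrees at least 2, a cut vertex, and
    a longest cycle missing a vertex of a nonseparable set. *)
Lemma degsum_le_induction K n0 (tau : nat -> nat) :
  cycle_degree_bounded K ->
  (forall n, n <= n0 -> n * K <= (tau n).*2.+1) ->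
  (forall n, 2 <= n <= n0 -> tau n.-1 < tau n) ->
  (forall a b n, 0 < a <= b -> b < n <= n0 -> a + b <= n.+1 -> a * a.-1 + (tau b).*2 <= (tau n).*2) ->
  (forall (U : {set T}) c d, #|U| <= n0 -> nonseparable U -> longest_cycle U c -> ~~ (U \subset c) ->
     (forall x, x \in U -> d <= deg U x) -> tau #|U| < tau #|U|.-1 + d ->
     degsum U <= (tau #|U|).*2) ->
  forall U : {set T}, #|U| <= n0 -> degsum U <= (tau #|U|).*2.
Proof.
move=> hK t0 t1 t2 t3 U; have [m] := ubnP #|U|; elim: m => // m IH in U *; rewrite ltnS => hm hn.
have [n1|n2] := leqP #|U| 1.
  have := degsum_le_complete U; rewrite (_ : #|U| * #|U|.-1 = 0).
    by rewrite leqn0 => /eqP ->.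
  by move: n1; case: #|U| => [|[|]].
have U0 : U != set0 by rewrite -card_gt0; apply: leq_trans n2.
(* A vertex of degree at most the increment of [tau] can be deleted; otherwise all degrees reach the
   [d] below. *)
have [[v [vU hv]]|hv] := EM (exists v, v \in U /\ tau #|U|.-1 + deg U v <= tau #|U|).
  have cU : #|U :\ v| = #|U|.-1 by rewrite (cardsD1 v U) vU.
  rewrite (degsum_rem vU); have := IH (U :\ v).
  rewrite cU; move: hm hn n2 hv; move: (degsum _) (deg U v) #|U| => a b n; clear.
  move=> h1 h2 h3 h4 h5.
  have h6 : n.-1 < m by move: h1 h3; clear; lia.
  have h7 : n.-1 <= n0 by move: h2; clear; lia.
  by move: (h5 h6 h7) h4; move: (tau _) (tau _) => c d; clear; lia.
pose d := (tau #|U| - tau #|U|.-1).+1.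
have tn : tau #|U|.-1 < tau #|U| by apply: t1; rewrite n2.
have hd x : x \in U -> d <= deg U x.
  move=> xU; rewrite /d leqNgt; apply/negP => h; case: hv; exists x; split=> //.
  by move: h tn; move: (deg _ _) (tau _) (tau _) => a b c; clear; lia.
have d2 : 2 <= d by rewrite /d; move: tn; move: (tau _) (tau _) => a b; clear; lia.
have [c lc] : exists c, longest_cycle U c.
  by apply: longest_cycle_exists => // x /hd; apply: leq_trans.
(* At a cut vertex the smaller side is bounded as a complete graph, the larger one by induction. *)
have [ns|nns] := EM (nonseparable U); last first.
  have [[y [M [MU M0 clM nU]]]|h] := EM (exists y (M : {set T}),
      [/\ M \subset U :\ y, M != set0, closed_in (U :\ y) M & ~~ (U \subset y |: M)]); last first.
    case: nns => y M MU M0 clM; apply/negPn/negP => nU; case: h; by exists y, M.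
  have sMU : M \subset U by apply: subset_trans MU (subD1set _ _).
  have yM : y \notin M by apply/negP => /(subsetP MU); rewrite !inE eqxx.
  apply: leq_trans (degsum_separation MU clM) _.
  have a0 : 0 < #|U :&: (y |: M)|.
    by rewrite card_gt0; case/set0Pn: M0 => z zM; apply/set0Pn; exists z;
       rewrite !inE zM orbT (subsetP sMU).
  have b0 : 0 < #|U :\: M|.
    case/subsetPn: nU => z zU; rewrite !inE negb_or => /andP[_ zM].
    by apply/card_gt0P; exists z; rewrite inE zM.
  have an : #|U :&: (y |: M)| < #|U|.
    apply: proper_card; rewrite properE subsetIl; case/subsetPn: nU => z zU zN.
    by apply/subsetPn; exists z; rewrite // inE (negbTE zN) andbF.
  have bn : #|U :\: M| < #|U|.
    apply: proper_card; rewrite properE subsetDl; case/set0Pn: M0 => z zM.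
    by apply/subsetPn; exists z; rewrite ?inE ?zM //; apply: (subsetP sMU).
  have abn : #|U :&: (y |: M)| + #|U :\: M| <= #|U|.+1.
    have := cardsID M U; rewrite (setIidPr sMU).
    have : #|U :&: (y |: M)| <= #|y |: M| by apply: subset_leq_card; apply: subsetIr.
    by rewrite cardsU1 yM; move: #|_| #|_| #|_| #|_| => a b k n; clear; lia.
  have hA := IH (U :&: (y |: M)) (leq_trans an hm) (ltnW (leq_trans an hn)).
  have hB := IH (U :\: M) (leq_trans bn hm) (ltnW (leq_trans bn hn)).
  have cA := degsum_le_complete (U :&: (y |: M)).
  have cB := degsum_le_complete (U :\: M).
  case: (leqP #|U :&: (y |: M)| #|U :\: M|) => [ab|/ltnW ba].
    by apply: leq_trans (leq_add cA hB) _; apply: t2; rewrite ?a0 ?bn.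
  rewrite addnC; apply: leq_trans (leq_add cB hA) _; apply: t2; rewrite ?b0 ?an //.
  by rewrite addnC.
have [Uc|Uc] := boolP (U \subset c); last first.
  apply: (t3 U c d) => //; rewrite /d; move: tn; move: (tau _) (tau _) => a b; clear; lia.
have [hc _] := lc; have [_ _ uc /allP aU] := and4P hc.
have EU : U = [set z in c].
  by apply/setP => z; rewrite inE; apply/idP/idP => [/(subsetP Uc)|/aU].
(* Hamiltonian case: the degree sum is even, which absorbs the extra 1. *)
have := degsum_cycle hK hc; rewrite -EU -(card_uniqP uc) -[#|c|]cardsE -EU => h.
have := leq_trans h (t0 _ hn); have := degsum_even U.
move: (degsum U) (tau _) => a b; clear; lia.
Qed.

End Graph.

(** * The inductive bound *)

Section Bounds.
Variables (T : finType) (e : rel T).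
Hypotheses (e_sym : symmetric e) (e_irr : irreflexive e).

Notation degsum := (degsum e).
Notation deg := (deg e).

Lemma dominating_degsum K (U : {set T}) c d (b : nat) : cycle_degree_bounded e K -> longest_cycle e U c ->
  {in U :\: [set z in c] &, forall x y, ~~ e x y} -> ~~ (U \subset c) ->
  (forall x, x \in U -> d <= deg U x) -> 2 <= d ->
  (forall s k, d <= s <= K -> 2 * s <= k -> k < #|U| ->
     2 * degsum U <= 2 * (k - s) * K + s * k + 4 * (#|U| - k) * s ->
     degsum U <= k * K + 2 * (#|U| - k) * s -> degsum U <= b) ->
  degsum U <= b.
Proof.
move=> hK lc ind /subsetPn[v0 v0U v0c] hd d2 hb.
have v0R : v0 \in U :\: [set z in c] by rewrite !inE v0c.
case: (arg_maxnP (deg U) v0R) => v vR' hmax; have vR : v \in U :\: [set z in c] by [].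
have dv : d <= deg U v by apply: hd; move: vR; rewrite !inE => /andP[].
have [h1 h2 h3 h4 h5] := dominating_cycle_bounds e_sym e_irr hK lc ind vR hmax (leq_trans d2 dv).
by apply: (hb (deg U v) (size c)) => //; rewrite dv.
Qed.

Lemma degsum_bound_large K n0 t : 5 <= K -> 5 * K = 2 * n0 + t -> 3 <= t <= 4 ->
  cycle_degree_bounded e K ->
  forall U : {set T}, #|U| <= n0 -> degsum U <= (edge_bound K n0 #|U|).*2.
Proof.
move=> K5 h0 ht hK; have hT := tri_le_bound K5 h0 ht.
apply: (degsum_le_induction e_sym e_irr hK).
- by move=> n; apply: (edge_bound_ham K5 h0 ht).
- by move=> n /andP[n2 _]; rewrite ltn_add2l; apply: tri_lt.
- move=> a b n ab _ abn; have := tri_block ab abn; rewrite /edge_bound.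
  by move: (tri _) (tri _) (_ - _) (a * _) => x y z w; clear; lia.
move=> U c d Un ns lc Uc hd; rewrite /edge_bound -addnA ltn_add2l => hstep.
have [/and4P[c2 _ uc /allP aU] _] := lc.
have n3 : 2 < #|U|.
  apply: leq_trans c2 _; rewrite -(card_uniqP uc); apply: subset_leq_card.
  by apply/subsetP => z /aU.
have nd : #|U| + 2 <= 3 * d by apply: tri_step => //; apply: leq_trans n3.
have dc := longest_cycle_min_degree e_sym e_irr ns lc Uc hd.
have ind := longest_cycle_dominating e_sym e_irr lc dc hd nd.
apply: (dominating_degsum hK lc ind Uc hd); first by move: nd n3; clear; lia.
move=> s k /andP[_ sK] sk kn; apply: (dominating_edge_bound K5 h0 ht Un sK sk kn).
exact: degsum_even.
Qed.

(** At the threshold 6 the edge bound is 9, which is [K (n0 - K)] for [K = 3]. *)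
Lemma degsum_bound_3 : cycle_degree_bounded e 3 ->
  forall U : {set T}, #|U| <= 6 -> degsum U <= ((#|U| * 3)./2).*2.
Proof.
move=> hK; apply: (degsum_le_induction (tau := fun n => (n * 3)./2) e_sym e_irr hK).
- by move=> n _ /=; clear; lia.
- by move=> n /=; clear; lia.
- move=> a b n /andP[a0 ab] /andP[bn n6] abn.
  have : a <= 3 by lia.
  by case: a a0 ab abn => [|[|[|[|a]]]] //= *; lia.
move=> U c d Un ns lc Uc hd /= hstep.
have [/and4P[c2 _ uc /allP aU] _] := lc.
have dc := longest_cycle_min_degree e_sym e_irr ns lc Uc hd.
have CU : [set z in c] \subset U by apply/subsetP => z; rewrite inE => /aU.
have cC : #|[set z in c]| = size c by rewrite cardsE (card_uniqP uc).
have cn : size c < #|U|.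
  rewrite -cC; apply: proper_card; rewrite properE CU; apply: contra Uc => /subsetP h.
  by apply/subsetP => z /h; rewrite inE.
have d2 : 2 <= d by move: hstep c2 cn Un; clear; lia.
have ind : {in U :\: [set z in c] &, forall x y, ~~ e x y}.
  (* When the hypothesis of the domination theorem fails, [2 * d <= size c] leaves at most one
     vertex off the cycle. *)
  have [nd|nd] := leqP (#|U| + 2) (3 * d).
    exact: (longest_cycle_dominating e_sym e_irr lc dc hd nd).
  have /card_le1_eqP h : #|U :\: [set z in c]| <= 1.
    rewrite cardsD (setIidPr CU) cC; move: dc nd Un hstep cn c2; clear; lia.
  by move=> x y xR yR; rewrite (h x y xR yR) e_irr.
apply: (dominating_degsum hK lc ind Uc hd d2) => s k /andP[ds sK] sk kn.
have := degsum_even e_sym e_irr U; move: (degsum U) => D.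
have : s = 2 \/ s = 3 by lia.
by case=> ->; move: kn sk Un hstep ds; clear; lia.
Qed.

(* Here a longest cycle need not be dominating when #|U| = 8: the two vertices off a
   6-cycle may be adjacent, with the same two neighbours on it. *)
Lemma degsum_bound_4 : cycle_degree_bounded e 4 ->
  forall U : {set T}, #|U| <= 8 -> degsum U <= ((#|U| * 4)./2).*2.
Proof.
move=> hK; apply: (degsum_le_induction (tau := fun n => (n * 4)./2) e_sym e_irr hK).
- by move=> n _ /=; clear; lia.
- by move=> n /=; clear; lia.
- move=> a b n /andP[a0 ab] /andP[bn n6] abn.
  have : a <= 4 by lia.
  by case: a a0 ab abn => [|[|[|[|[|a]]]]] //= *; lia.
move=> U c d Un ns lc Uc hd /= hstep.
have [hc _] := lc.
have [/and4P[c2 _ uc aU'] _] := lc; have /allP aU := aU'.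
have dc := longest_cycle_min_degree e_sym e_irr ns lc Uc hd.
set C := [set z in c].
have CU : C \subset U by apply/subsetP => z; rewrite inE => /aU.
have cC : #|C| = size c by rewrite cardsE (card_uniqP uc).
have cn : size c < #|U|.
  rewrite -cC; apply: proper_card; rewrite properE CU; apply: contra Uc => /subsetP h.
  by apply/subsetP => z /h; rewrite inE.
have d3 : 3 <= d by move: hstep c2 cn Un; clear; lia.
have [ind|nind] := EM {in U :\: C &, forall x y, ~~ e x y}.
  apply: (dominating_degsum hK lc ind Uc hd) => [|s k /andP[ds sK] sk kn].
    exact: leq_trans d3.
  have := degsum_even e_sym e_irr U; move: (degsum U) => D.
  have : s = 3 \/ s = 4 by lia.
  by case=> sE; subst s; move: kn sk Un hstep ds; clear; lia.
have [[x0 [y0 [x0R y0R exy]]]|nex] := EM (exists x y, [/\ x \in U :\: C, y \in U :\: C & e x y]); last first.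
  by case: nind => x y xR yR; apply/negP => exy; case: nex; exists x, y.
have [x [q [pq q0 d1 d2 hs]]] := path_off_of_edge e_sym e_irr uc aU' hd x0R y0R exy.
have hR : #|U :\: C| = #|U| - size c by rewrite cardsD (setIidPr CU) cC.
(* The inequalities force a 6-cycle, 8 vertices and a single edge as longest path off the cycle. *)
have /and5P[c6 q1 n8 dx dl] : [&& size c == 6, size q == 1, #|U| == 8, 2 <= deg C x & 2 <= deg C (last x q)].
  move: dc d3 hs q0 d1 d2 Un; rewrite -/C; move: (deg C x) (deg C _) (size c) (size q) #|U| => a b k m n; clear => *.
  by apply/and5P; split; lia.
have Yc (Y : {set T}) : Y :&: C \subset c by apply/subsetP => z; rewrite !inE => /andP[].
have [a1 a1Y] : exists a1, a1 \in nbr e (last x q) :&: C by apply/card_gt0P; apply: leq_trans dl.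
have [a0 a0Y a01] : exists2 a0, a0 \in nbr e x :&: C & a0 != a1.
  have : 0 < #|(nbr e x :&: C) :\ a1|.
    have := cardsD1 a1 (nbr e x :&: C); move: dx; rewrite -/(deg C x).
    by move: (deg C x) #|_| => b b'; clear; case: (_ \in _) => /=; lia.
  by case/card_gt0P => a0; rewrite in_setD1 => /andP[h1 h2]; exists a0.
have := gap_bound e_sym (subsetIl (nbr e x) C) (subsetIl (nbr e (last x q)) C)
  lc pq (Yc _) (Yc _) a0Y a1Y a01.
rewrite (eqP c6) (eqP q1) mul1n => hgap.
(* Twice the union plus 2 is at most 6, so both ends have the same two neighbours. *)
have hA : #|nbr e x :&: C :|: nbr e (last x q) :&: C| <= 2.
  by move: hgap (leq_maxl 2 (1 * #|nbr e x :&: C :&: (nbr e (last x q) :&: C)|)); clear; lia.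
have xlR : x != last x q.
  move: pq q1 => /and3P[_ + _]; case: (q) => [//|w [|//]] /=.
  by rewrite inE andbT.
have inR z : z \in x :: q -> z \in U :\: C.
  by move: pq => /and3P[_ _ /allP h] /h; rewrite !inE andbC.
have xR := inR x (mem_head _ _); have lR := inR _ (mem_last x q).
have ER : U :\: C = [set x; last x q].
  apply/eqP; rewrite eq_sym eqEcard subUset !sub1set xR lR cards2 xlR hR.
  by rewrite (eqP c6) (eqP n8).
have cA : #|nbr e x :&: C| = 2.
  apply/eqP; rewrite eqn_leq [_ <= #|_|]dx andbT.
  by apply: leq_trans (subset_leq_card (subsetUl _ _)) hA.
have cl : deg C (last x q) = 2.
  apply/eqP; rewrite eqn_leq dl andbT.
  by apply: leq_trans (subset_leq_card (subsetUr _ _)) hA.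
have px : path_off e U c x [::].
  by move: pq => /and3P[_ _ /andP[h _]]; rewrite /path_off /= h.
have hsucc : 2 * degsum C <= 44.
  have := degsum_cycle_succ e_sym e_irr hK lc (Yc (nbr e x)).
  rewrite cA (eqP c6) => /(_ (leqnn _)); apply.
  move=> u v; rewrite !inE => /andP[exu _] /andP[exv _] _.
  by exists x, [::]; split=> //; rewrite e_sym.
(* The total is at most [22 + 2 (2 + 2) + 2 = 32], twice the bound 16. *)
rewrite (degsum_split e_sym CU); have := degsum_le_complete e_irr (U :\: C).
have xN : x \notin [set last x q] by rewrite inE.
rewrite ER cards2 xlR (big_setU1 _ xN) /= big_set1 cl.
have -> : deg C x = 2 by exact: cA.
by rewrite (eqP n8); move: hsucc; move: (degsum C) (degsum _) => a b; clear; lia.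
Qed.
End Bounds.

(** Above the threshold, deleting a vertex of degree at most [k + 1] matches the slope of the bound;
    at the threshold the bounds for at most [n0] vertices apply. *)
Lemma degsum_bound (T : finType) (e : rel T) k (U : {set T}) : symmetric e -> irreflexive e ->
  2 <= k -> cycle_degree_bounded e k.+1 -> uphalf (5 * k + 1) <= #|U| ->
  degsum e U <= (k.+1 * (#|U| - k.+1)).*2.
Proof.
move=> e_sym e_irr k2 hK; have [m] := ubnP #|U|; elim: m => // m IH in U *; rewrite ltnS => hm.
rewrite leq_eqVlt => /orP[/eqP hn|hn].
  have [k4|k4] := leqP 4 k.
    (* Doubling [uphalf m] gives [m + odd m], here with [m = 5 k + 1]. *)
    pose t := 4 - odd (5 * k + 1).
    have ht : 3 <= t <= 4 by rewrite /t; case: odd.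
    have h0 : 5 * k.+1 = 2 * uphalf (5 * k + 1) + t.
      rewrite /t; clear; have := odd_uphalfK; lia.
    have := degsum_bound_large e_sym e_irr (_ : 5 <= k.+1) h0 ht hK (_ : #|U| <= _).
    rewrite -hn /edge_bound subnK; last exact: (tri_le_bound (_ : 5 <= k.+1) h0 ht).
    by apply.
  have [k2'|k3] : k = 2 \/ k = 3 by move: k2 k4; clear; lia.
    subst k; have := degsum_bound_3 e_sym e_irr hK (_ : #|U| <= 6); rewrite -hn; exact.
  by subst k; have := degsum_bound_4 e_sym e_irr hK (_ : #|U| <= 8); rewrite -hn; exact.
have n0 : k.+2 <= uphalf (5 * k + 1) by move: k2; clear; lia.
have U0 : U != set0 by rewrite -card_gt0; apply: leq_trans hn.
have [v vU dv] := min_degree_le e_sym e_irr (ltn0Sn k) hK U0.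
have cU : #|U| = (#|U :\ v|).+1 by rewrite (cardsD1 v) vU.
have := IH (U :\ v); rewrite (degsum_rem e_sym e_irr vU); rewrite cU in hm hn *.
move=> /(_ hm hn); move: hn n0 dv; move: (degsum _ _) (deg _ _ _) #|_| => a b n.
have -> : (n.+1 - k.+1) = n - k by [].
move=> h1 h2 h3.
have -> : n - k = (n - k.+1).+1 by move: h1 h2; clear; lia.
by move: h3; clear; lia.
Qed.

(** * Edge sets and chords *)

Section EdgeSets.
Variables (T : finType) (E : {set {set T}}).
Hypothesis sE : simple_graph E.

Lemma adj_sym : symmetric (adj E).
Proof. by move=> x y; rewrite /adj setUC. Qed.

Lemma adj_irr : irreflexive (adj E).
Proof.
move=> x; apply/negP => xE; move/forallP: sE => /(_ [set x; x]) /implyP /(_ xE).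
by rewrite setUid cards1.
Qed.

Lemma set2_inj (x : T) : injective (fun y => [set x; y]).
Proof.
move=> y z /= h; have : y \in [set x; z] by rewrite -h !inE eqxx orbT.
rewrite !inE => /orP[/eqP yx|/eqP//].
have : z \in [set x; y] by rewrite h !inE eqxx orbT.
by rewrite !inE yx orbb => /eqP ->.
Qed.

Lemma edge_of_mem s x : s \in E -> x \in s -> exists2 y, s = [set x; y] & adj E x y.
Proof.
move=> sE' xs; move/forallP: sE => /(_ s) /implyP /(_ sE').
rewrite (cardsD1 x) xs => /eqP[] /eqP /cards1P[y hy].
have h : s = [set x; y] by rewrite -(setD1K xs) hy.
by exists y => //; rewrite /adj -h.
Qed.

Lemma deg_edges (U : {set T}) x : x \in U ->
  deg (adj E) U x = #|[set s in E | (x \in s) && (s \subset U)]|.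
Proof.
move=> xU; rewrite /deg -(card_imset _ (@set2_inj x)); apply: eq_card => s.
rewrite !inE; apply/imsetP/and3P => [[y]|[s1 xs sU]].
  rewrite !inE => /andP[exy yU] ->; split=> //; first by rewrite !inE eqxx.
  by rewrite subUset !sub1set xU yU.
have [y ys exy] := edge_of_mem s1 xs; exists y => //; rewrite !inE exy.
by apply: (subsetP sU); rewrite ys !inE eqxx orbT.
Qed.

Lemma degsum_edges : degsum (adj E) setT = (#|E|).*2.
Proof.
rewrite /degsum.
transitivity (\sum_(x in [set: T]) \sum_(s in E) (x \in s : nat)).
  apply: eq_bigr => x _; rewrite deg_edges ?inE // -sum1_card big_mkcond [RHS]big_mkcond.
  by apply: eq_bigr => s _; rewrite !inE subsetT andbT; case: (s \in E); case: (x \in s).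
rewrite exchange_big /= -muln2 -sum_nat_const; apply: eq_bigr => s sE'.
move/forallP: sE => /(_ s) /implyP /(_ sE') /eqP <-.
rewrite -sum1_card big_mkcond [RHS]big_mkcond; apply: eq_bigr => x _.
by rewrite inE; case: (x \in s).
Qed.

Lemma next_neq_prev (c : seq T) v : 2 < size c -> uniq c -> v \in c -> next c v != prev c v.
Proof.
move=> c2 uc vc; have [i l El] := rot_to vc.
have ul : uniq (v :: l) by rewrite -El rot_uniq.
have sl : 2 < size (v :: l) by rewrite -El size_rot.
rewrite -(next_rot i uc) -(prev_rot i uc) El.
apply/eqP => h; have := congr1 (next (v :: l)) h; rewrite next_prev //.
case: l El ul sl h => [//|a [//|b l]] El ul _.
move: ul; rewrite /= !inE !negb_or => /andP[/and3P[va vb _] _].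
by rewrite eqxx [a == v]eq_sym (negbTE va) eqxx => _ /eqP; rewrite eq_sym (negbTE vb).
Qed.

(** Of the edges at [v] inside [c], exactly the two to its cyclic neighbours are not chords; they
    differ because [c] has more than two vertices. *)
Lemma chords_at_deg c v : is_cycle E c -> v \in c ->
  #|chords_at E c v| + 2 = deg (adj E) [set y in c] v.
Proof.
move=> /andP[c2 /andP[cyc uc]] vc; rewrite deg_edges ?inE //.
set D := [set s in E | _].
pose s1 := [set v; next c v]; pose s2 := [set prev c v; v].
have DE s : (s \in D) = [&& s \in E, v \in s & s \subset c].
  rewrite inE; congr [&& _, _ & _]; apply: eq_subset_r => z; by rewrite inE.
have s1D : s1 \in D.
  rewrite DE [_ \in E](next_cycle cyc vc) !inE eqxx /=.
  by apply/subsetP => z; rewrite !inE => /orP[]/eqP->; rewrite ?mem_next.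
have s2D : s2 \in D.
  rewrite DE [_ \in E](prev_cycle cyc vc) !inE eqxx orbT /=.
  by apply/subsetP => z; rewrite !inE => /orP[]/eqP->; rewrite ?mem_prev.
have s12 : s1 != s2.
  apply: contra (next_neq_prev c2 uc vc) => /eqP; rewrite /s1 /s2 [X in _ = X]setUC.
  by move/set2_inj => ->.
have -> : chords_at E c v = D :\ s1 :\ s2.
  apply/setP => s; rewrite !in_setD1 DE !inE.
  apply/andP/and4P => [[/and3P[sE' sc /forallP h] vs]|[h2 h1 sE' /andP[vs sc]]].
    split; rewrite ?sE' ?vs ?sc //.
      have /implyP := h (prev c v); rewrite mem_prev next_prev // => /(_ vc).
      by apply: contraNneq => ->.
    by have /implyP := h v => /(_ vc).
  split=> //; apply/and3P; split=> //; apply/forallP => x; apply/implyP => xc.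
  apply/eqP => sx; move: vs; rewrite sx !inE => /orP[/eqP vx|/eqP vx].
    by move: h1; rewrite sx /s1 vx eqxx.
  by move: h2; rewrite sx /s2 vx prev_next // eqxx.
have := cardsD1 s1 D; have := cardsD1 s2 (D :\ s1).
by rewrite in_setD1 s1D s2D [s2 == s1]eq_sym s12 => /= -> ->; rewrite addnC addnA.
Qed.

Lemma is_cycleE c : is_cycle E c = cycle_in (adj E) setT c.
Proof.
have aT : all (mem [set: T]) c by apply/allP => z _; rewrite /= inE.
by rewrite /is_cycle /cycle_in aT andbT.
Qed.

Lemma chord_cycle_free_bounded k : chord_cycle_free k E -> cycle_degree_bounded (adj E) k.+1.
Proof.
move=> hE c v hc vc; rewrite leqNgt; apply/negP => h; apply: hE; exists c, v.
rewrite -is_cycleE in hc; split=> //.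
by move: h; rewrite -(chords_at_deg hc vc); clear; lia.
Qed.

Lemma edges_le k : 2 <= k -> chord_cycle_free k E -> uphalf (5 * k + 1) <= #|T| ->
  #|E| <= k.+1 * (#|T| - k.+1).
Proof.
move=> k2 /chord_cycle_free_bounded hK; rewrite -cardsT => hn.
by have := degsum_bound adj_sym adj_irr k2 hK hn; rewrite degsum_edges leq_double.
Qed.
End EdgeSets.

(** * Constructions *)

Section Construction.
Variables (n a : nat) (f : bool).

(** Pairs the indices [2 i] and [2 i + 1] when [f] is set; for odd [a] the index [a - 1] stays
    single. *)
Definition matched (x y : nat) : bool :=
  [&& f, x != y, x./2 == y./2, x < a./2.*2 & y < a./2.*2].

Definition join_rel : rel 'I_n := fun x y =>
  [|| x < a <= y, y < a <= x | matched x y].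

Definition join_graph : {set {set 'I_n}} :=
  [set [set p.1; p.2] | p in [set p : 'I_n * 'I_n | join_rel p.1 p.2]].

Lemma join_rel_sym : symmetric join_rel.
Proof.
move=> x y; rewrite /join_rel /matched; move: (x : nat) (y : nat) f => u v b.
by clear; case: b; lia.
Qed.

Lemma join_rel_irr : irreflexive join_rel.
Proof. by move=> x; rewrite /join_rel /matched eqxx andbF orbF orbb; lia. Qed.

Lemma join_graph_simple : simple_graph join_graph.
Proof.
apply/forallP => s; apply/implyP => /imsetP[[x y]]; rewrite inE /= => rxy ->.
rewrite cards2; have -> // : x != y.
by apply: contraTneq rxy => ->; rewrite join_rel_irr.
Qed.

Lemma adj_join_graph : adj join_graph =2 join_rel.
Proof.
move=> x y; apply/imsetP/idP => [[[u v]]|rxy]; last by exists (x, y); rewrite ?inE.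
rewrite inE /= => ruv h.
have : x \in [set u; v] by rewrite -h !inE eqxx.
rewrite !inE => /orP[] /eqP xu; move: h; rewrite {x}xu.
  by move=> /set2_inj ->.
by rewrite [X in _ = X]setUC => /set2_inj ->; rewrite join_rel_sym.
Qed.

Lemma matched_le1 (x : 'I_n) : #|[set y : 'I_n | matched x y]| <= f.
Proof.
rewrite /matched; case: f => /=; last by rewrite (_ : [set y | _] = set0) ?cards0 //; apply/setP => y; rewrite !inE.
apply/card_le1_eqP => y z; rewrite !inE => /and4P[h1 /eqP h2 _ _] /and4P[h3 /eqP h4 _ _].
by apply: val_inj => /=; move: h1 h2 h3 h4; clear; lia.
Qed.

(* A cycle has at most as many vertices outside the first [a] as inside, since
   the outer vertices are independent and hence have their successors inside. *)
Lemma cycle_outer_le (c : seq 'I_n) : cycle join_rel c -> uniq c ->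
  #|[set x in c | a <= x]| <= #|[set x in c | x < a]|.
Proof.
move=> cyc uc; rewrite -(card_imset _ (can_inj (prev_next uc))).
apply: subset_leq_card; apply/subsetP => w /imsetP[x]; rewrite inE => /andP[xc ax] ->.
rewrite inE mem_next xc /=; have := next_cycle cyc xc.
by rewrite /join_rel /matched; move: ax; move: (nat_of_ord (next c x)) (nat_of_ord x) => y z; clear; lia.
Qed.

Lemma initial_card m : m <= n -> #|[set x : 'I_n | x < m]| = m.
Proof.
move=> mn; rewrite -sum1dep_card -(big_ord_widen n (fun=> 1) mn).
by rewrite sum1_card card_ord.
Qed.

(** A cycle has at most [a] vertices on either side. An inner vertex sees the outer ones and at most
    [f] partners, an outer vertex only inner ones. *)
Lemma join_graph_free k : a <= n -> a + f <= k.+1 -> chord_cycle_free k join_graph.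
Proof.
move=> an afk [c [v [hc vc hk]]].
have hd := chords_at_deg join_graph_simple hc vc.
move: hc => /andP[c2 /andP[cyc uc]].
have cyc' : cycle join_rel c by rewrite -(eq_cycle adj_join_graph).
have hA : #|[set x in c | x < a]| <= a.
  rewrite -{2}(initial_card an); apply: subset_leq_card; apply/subsetP => x.
  by rewrite !inE => /andP[].
have hB := leq_trans (cycle_outer_le cyc' uc) hA.
suff : deg (adj join_graph) [set y in c] v <= a + f by rewrite -hd; lia.
have [va|va] := ltnP v a.
  apply: leq_trans (leq_add hB (matched_le1 v)); apply: leq_trans (leq_card_setU _ _).
  apply: subset_leq_card; apply/subsetP => y; rewrite !inE adj_join_graph => /andP[ry ->].
  by move: ry va; rewrite /join_rel /=; move: (matched v y) => b; clear; lia.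
apply: leq_trans (leq_addr _ _); apply: leq_trans hA.
apply: subset_leq_card; apply/subsetP => y; rewrite !inE adj_join_graph => /andP[ry ->].
by move: ry va; rewrite /join_rel /matched /=; clear; lia.
Qed.

Lemma join_graph_edges : a <= n -> #|join_graph| = a * (n - a) + f * a./2.
Proof.
move=> an; apply: double_inj; rewrite -(degsum_edges join_graph_simple).
pose A := [set x : 'I_n | x < a]; have cA : #|A| = a by apply: initial_card.
have degJ U x : deg (adj join_graph) U x = \sum_(y in U) join_rel x y.
  by rewrite degE; apply: eq_bigr => y _; rewrite adj_join_graph.
rewrite (degsum_split (adj_sym _) (subsetT A)) [X in _ + X](_ : _ = 0); last first.
  apply: big1 => x xA; rewrite degJ; apply: big1 => y yA.
  move: xA yA; rewrite !inE !andbT /join_rel /matched; clear; lia.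
have -> : \sum_(v in [set: 'I_n] :\: A) deg (adj join_graph) A v = (n - a) * a.
  have <- : #|[set: 'I_n] :\: A| = n - a by rewrite cardsD setTI cardsT card_ord cA.
  rewrite -sum_nat_const; apply: eq_bigr => x; rewrite !inE andbT => xA.
  rewrite degJ -cA -sum1_card; apply: eq_bigr => y; rewrite inE => yA.
  suff -> : join_rel x y by [].
  by move: xA yA; rewrite /join_rel; clear; lia.
have -> : degsum (adj join_graph) A = f * a./2.*2.
  have h2 : a./2.*2 <= n by move: an; clear; lia.
  rewrite -[in RHS](initial_card h2) /degsum.
  transitivity (\sum_(x in A) f * (x < a./2.*2)).
    apply: eq_bigr => x; rewrite inE => xa; rewrite degJ.
    have [fx|nfx] := boolP (f && (x < a./2.*2)); last first.
      rewrite big1 => [|y yA]; last by move: yA nfx xa; rewrite inE /join_rel /matched; clear; case: f => /=; lia.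
      by move: nfx; case: f => //= /negbTE ->.
    have [f1 xh] := andP fx; rewrite f1 xh.
    have yn : (if odd x then x.-1 else x.+1) < n by move: xh h2; clear; case: ifP; lia.
    have yA : Ordinal yn \in A by rewrite inE /=; move: xh; clear; case: ifP; lia.
    rewrite (big_setD1 _ yA) /= big1 => [|y]; last first.
      rewrite !inE => /andP[yy ya]; have {}yy : y != (if odd x then x.-1 else x.+1) :> nat by [].
      by move: yy ya xa; rewrite /join_rel /matched; clear; case: ifP; lia.
    rewrite addn0; suff -> : join_rel x (Ordinal yn) by [].
    by move: xh; rewrite /join_rel /matched f1 /=; clear; case: ifP; lia.
  rewrite -big_distrr /= -sum1_card; congr (_ * _); rewrite big_mkcond [RHS]big_mkcond.
  apply: eq_bigr => x _; rewrite !inE; move: (x : nat) => y; clear.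
  case: ifP; case: ifP; lia.
by move: a f; clear; lia.
Qed.
End Construction.

Theorem mainTheorem2 (k : nat) (hk : 2 <= k) :
  (forall n : nat, uphalf (5 * k + 1) <= n -> g k n = (k + 1) * (n - k - 1)) /\
  (forall n : nat, n = uphalf (5 * k + 1) - 1 ->
     exists E : {set {set 'I_n}},
       [/\ simple_graph E,
           #|E| = (k + 1) * (n - k - 1) + 1
         & chord_cycle_free k E]).
Proof.
split=> [n hn|n hn].
  have -> : (k + 1) * (n - k - 1) = k.+1 * (n - k.+1) by rewrite -subnDA !addn1.
  apply/eqP; rewrite eqn_leq; apply/andP; split.
    apply/bigmax_leqP => E /andP[sE /asboolP fE].
    by have := edges_le sE hk fE; rewrite card_ord; apply.
  have kn : k.+1 <= n by move: hn hk; clear; lia.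
  (* The extremal graph is complete bipartite with sides [k + 1] and [n - k - 1]. *)
  have := join_graph_edges false kn; rewrite mul0n addn0 => <-.
  apply: (@leq_bigmax_cond _ _ (fun E : {set {set 'I_n}} => #|E|)).
  rewrite join_graph_simple; apply/asboolP; apply: join_graph_free => //.
  by rewrite addn0.
have kn : k <= n by move: hn hk; clear; lia.
exists (join_graph n k true); split.
- exact: join_graph_simple.
- rewrite join_graph_edges // mul1n.
  (* With [h = k./2] the edge count is [k (k + h) + h = (k + 1) (k + h - 1) + 1]. *)
  have -> : n = 2 * k + k./2 by move: hn; clear; lia.
  have -> : 2 * k + k./2 - k = k + k./2 by clear; lia.
  have -> : k + k./2 - 1 = (k + k./2).-1 by rewrite subn1.
  by move: hk; clear; nia.
- by apply: join_graph_free; rewrite ?addn1.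
Qed.
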